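(* Consider the urban-system model with a transit outside option described in the context. Suppose $\mu_f<\lambda$ and users choose between two modes: traveling by car through an urban system characterized by a triangular MFD with maximal throughput $\mu_f$ attained at the critical accumulation $n_c$ and with jam accumulation $n_j>n_c$, and using public transit with fixed cost $z_T$, where $z_T\ge z_C$ and all trips are of a fixed distance $D$. Let $\underline{\tau}\ge 0$ be the minimum toll at which there is some user that is indifferent between using car and transit. Then the revenue under any static toll $\tau\in[\underline{\tau},\, z_T-z_C]$ is given by $$R(\tau) = \tau\left[\frac{\Lambda}{\lambda}\,\frac{n_j}{\frac{n_j}{\mu_f}+z_T-z_C-\tau} + n_j\,\frac{e+L}{eL}\,\ln\left(1+\frac{(z_T-z_C-\tau)\mu_f}{n_j}\right)\left(1-\frac{1}{\lambda}\cdot\frac{n_j}{\frac{n_j}{\mu_f}+z_T-z_C-\tau}\right)\right].$$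
   Context: Urban system model. A continuum of users of total mass $\Lambda>0$ has desired exit times $t^*$ from the urban system uniformly distributed over $[t_1,t_2]$, with desired rate $\lambda=\Lambda/(t_2-t_1)$. Each user travels either by car through the urban system or by public transit. The system has a state-dependent outflow capacity (throughput) $\mu(n)$, where $n$ is the number of vehicles in the system; $n\mapsto\mu(n)$ is the macroscopic fundamental diagram (MFD). The triangular MFD is $$\mu(n)=\mu_f\,\frac{n}{n_c}\ \ (0\le n\le n_c),\qquad \mu(n)=\mu_f\,\frac{n_j-n}{n_j-n_c}\ \ (n_c\le n\le n_j).$$ All car trips have the same length $D$, the system speed at accumulation $n$ is $v(n)=D\mu(n)/n$, and so the delay over free flow when the accumulation is $n$ is $w(n)=\frac{n}{\mu(n)}-\frac{n_c}{\mu_f}\ge 0$ (zero for $n\le n_c$). With $n(t)$ the number of vehicles in the system at time $t$, cars exit at rate $\mu(n(t))$ and the waiting delay is $w(t)=w(n(t))$. Costs are normalized by the value of waiting time. A car user with desired exit time $t^*$ who exits at time $t$ pays $$c(t,t^* ) = z_C + w(t) + e\,(t^*-t)_+ + L\,(t-t^* )_+ + \tau(t),$$ where $z_C$ is the free-flow cost of a car trip, $0<e<1$ and $L>0$ are the earliness and lateness penalties, and $\tau(t)\ge0$ is the toll; a static toll has $\tau(t)=\tau$ for all $t$. A transit user pays the fixed cost $z_T$ and arrives at the desired time. Equilibrium: given the toll, every user chooses a mode and, if traveling by car, an exit time so as to minimize own cost given $w(\cdot)$, and no user has an incentive to deviate; car users exit in order of their desired exit times. When users are indifferent between car and transit, ties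 are broken in favor of higher-revenue outcomes (in particular the system operates at $n_c$, throughput $\mu_f$, when delays are zero during the interval over which cars exit). Revenue: with $[t_A,t_D]$ the interval over which car users exit at equilibrium under static toll $\tau$, $R(\tau)=\tau\int_{t_A}^{t_D}\mu(n(t))\,dt$, i.e. $\tau$ times the mass of car users. *)

(* Defs.v *)
From HB Require Import structures.
From mathcomp Require Import all_boot all_order all_algebra.
From mathcomp Require Import all_classical all_reals all_analysis.
From mathcomp Require Import ring lra.

Set Implicit Arguments.
Unset Strict Implicit.
Unset Printing Implicit Defensive.

Import Order.TTheory GRing.Theory Num.Theory.
Local Open Scope classical_set_scope.
Local Open Scope ring_scope.

Record urban_model (R : realType) := UrbanModel {
  Lambda : R;          (* total mass of users *)
  t1 : R; t2 : R;      (* desired exit times are uniform on [t1, t2] *)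
  mu_f : R;            (* maximal throughput *)
  n_c : R;             (* critical accumulation *)
  n_j : R;             (* jam accumulation *)
  trip_length : R;
  z_C : R;             (* free-flow cost of a car trip *)
  z_T : R;             (* cost of transit *)
  early : R;           (* earliness penalty e *)
  late : R             (* lateness penalty L *)
}.

Section Model.
Context {R : realType}.
Variable P : urban_model R.

Definition lambda : R := Lambda P / (t2 P - t1 P).

(* Triangular MFD; only meaningful for 0 <= n <= n_j. *)
Definition mfd (n : R) : R :=
  if n <= n_c P then mu_f P * (n / n_c P)
  else mu_f P * ((n_j P - n) / (n_j P - n_c P)).

Definition speed (n : R) : R := trip_length P * mfd n / n.

(* Travel time D / v(n) in excess of the free-flow time n_c / mu_f.  The empty
   system is singled out because speed 0 is the junk value 0 / 0 = 0, whereas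
   the delay is 0 at every n <= n_c.  Only meaningful for 0 <= n < n_j, as
   traffic stops at n_j. *)
Definition delay (n : R) : R :=
  if n == 0 then 0 else trip_length P / speed n - n_c P / mu_f P.

Lemma delayE (n : R) : 0 < trip_length P -> n != 0 ->
  delay n = n / mfd n - n_c P / mu_f P.
Proof.
move=> D0 n0; rewrite /delay (negbTE n0) /speed !invfM invrK.
by rewrite !mulrA divff ?gt_eqF// mul1r [in LHS]mulrC.
Qed.

Lemma delay_free_flow (n : R) : 0 < trip_length P -> 0 < mu_f P ->
  0 <= n <= n_c P -> delay n = 0.
Proof.
move=> D0 m0 /andP[n0 nnc]; have [->|nn0] := eqVneq n 0.
  by rewrite /delay eqxx.
have np : 0 < n by rewrite lt_neqAle eq_sym nn0.
have ncp : 0 < n_c P by exact: lt_le_trans nnc.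
rewrite delayE// /mfd nnc; field.
by rewrite !gt_eqF.
Qed.

(* Cost of exiting by car at time t for a desired exit time x, when the delay
   of a car exiting at time t is w t. *)
Definition car_cost (w toll : R -> R) (t x : R) : R :=
  z_C P + w t + early P * Num.max (x - t) 0 + late P * Num.max (t - x) 0
  + toll t.

(* A mode and exit-time choice for the continuum of users.  Users with desired
   exit time x have density lambda on [t1, t2]; among them a density
   car_rate x in [0, lambda] travels by car and exits at exit_time x, and the
   others take transit. *)
Record outcome := Outcome {
  accum : R -> R;       (* n(t) *)
  car_rate : R -> R;
  exit_time : R -> R;   (* irrelevant where car_rate vanishes *)
  t_A : R; t_D : R      (* cars exit over [t_A, t_D] *)
}.

Definition desired (x : R) : Prop := t1 P <= x <= t2 P.

Definition has_car (E : outcome) (x : R) : Prop :=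
  desired x /\ 0 < car_rate E x.

Definition has_transit (E : outcome) (x : R) : Prop :=
  desired x /\ car_rate E x < lambda.

Definition wait (E : outcome) (t : R) : R := delay (accum E t).

Record equilibrium (toll : R -> R) (E : outcome) : Prop := Equilibrium {
  accum_measurable : measurable_fun setT (accum E);
  accum_range : forall t, 0 <= accum E t < n_j P;
  exit_interval : t_A E <= t_D E;
  (* no car exits outside [t_A, t_D], i.e., mfd (n(t)) = 0 with n(t) < n_j *)
  accum_outside : forall t, ~ (t_A E <= t <= t_D E) -> accum E t = 0;
  car_rate_measurable : measurable_fun `[t1 P, t2 P] (car_rate E);
  car_rate_range : forall x, desired x -> 0 <= car_rate E x <= lambda;
  exit_time_range : forall x, has_car E x -> t_A E <= exit_time E x <= t_D E;
  exit_order : forall x y, has_car E x -> has_car E y -> x <= y ->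
    exit_time E x <= exit_time E y;
  (* cars exit at rate mfd (n(t)) *)
  exit_flow : forall t,
    \int[lebesgue_measure]_(x in [set x | has_car E x /\ exit_time E x <= t])
      car_rate E x
    = \int[lebesgue_measure]_(s in `]-oo, t]) mfd (accum E s);
  car_optimal : forall x, has_car E x ->
    (forall t, car_cost (wait E) toll (exit_time E x) x
               <= car_cost (wait E) toll t x)
    /\ car_cost (wait E) toll (exit_time E x) x <= z_T P;
  transit_optimal : forall x, has_transit E x ->
    forall t, z_T P <= car_cost (wait E) toll t x
}.

Definition static_toll (tau : R) : R -> R := fun=> tau.

Definition revenue (tau : R) (E : outcome) : R :=
  tau * \int[lebesgue_measure]_(t in `[t_A E, t_D E]) mfd (accum E t).

(* Equilibrium under a static toll, with ties broken in favor of revenue. *)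
Record selected_equilibrium (tau : R) (E : outcome) : Prop := Selected {
  selected_is_equilibrium : equilibrium (static_toll tau) E;
  selected_critical : forall t, t_A E <= t <= t_D E -> wait E t = 0 ->
    accum E t = n_c P;
  selected_max : forall E', equilibrium (static_toll tau) E' ->
    revenue tau E' <= revenue tau E
}.

(* The best car trip available to a user with desired exit time x costs
   exactly z_T. *)
Definition indifferent (tau : R) (E : outcome) (x : R) : Prop :=
  (exists t, car_cost (wait E) (static_toll tau) t x = z_T P)
  /\ (forall t, z_T P <= car_cost (wait E) (static_toll tau) t x).

Definition has_indifferent_user (tau : R) : Prop :=
  exists2 E, selected_equilibrium tau E &
    exists2 x, desired x & indifferent tau E x.

Definition is_min_indifference_toll (tau : R) : Prop :=
  [/\ 0 <= tau, has_indifferent_user tau &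
      forall tau', 0 <= tau' -> has_indifferent_user tau' -> tau <= tau'].

End Model.

(* Main.v *)
(* Write K = z_T - z_C - tau, g(w) for the outflow at delay w, and h(x) for the
   least delay-plus-schedule cost over all exit times of a user with desired
   exit time x. In any equilibrium h <= K on [t1, t2], and all users with
   h(x) < K drive. Let H be the maximum of h, attained first at x1 and last at
   x2. The cars that exit before x1 are exactly those of the users x < x1; as
   the outflow is at most mu_f < lambda, these users exit early. Their
   indifference between nearby exit times forces the delay to be e(t - x1) + H
   on (x1 - H/e, x1), with no exit before, so that lambda (x1 - t1) is an
   explicit logarithm. The same holds after x2 by reversing time, and on
   [x1, x2] the delay is at least H, hence the outflow at most g(H).
   If H < K, all users drive, x1 = x2, and the ramps carry the whole mass: they
   would carry more at level K. An equilibrium with an indifferent user has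
   H = K, so at tau_min, hence at tau, the ramps at level K fit in the total
   mass. Thus H = K at tau and the formula bounds the revenue of every
   equilibrium; the trapezoidal delay profile attains it. *)

Require Import Defs.
From HB Require Import structures.
From mathcomp Require Import all_boot all_order all_algebra.
From mathcomp Require Import all_classical all_reals all_analysis.
From mathcomp Require Import measurable_realfun ring lra.

Set Implicit Arguments.
Unset Strict Implicit.
Unset Printing Implicit Defensive.

Import Order.TTheory GRing.Theory Num.Theory.
Import numFieldNormedType.Exports.
Local Open Scope classical_set_scope.
Local Open Scope ring_scope.

(** * The delay before the first costliest user *)

(** The part of the car cost that depends on the choice of exit time once the toll is static. *)
Definition trip_cost (R : realType) (w : R -> R) (e L x t : R) : R :=
  w t + e * Num.max (x - t) 0 + L * Num.max (t - x) 0.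

Lemma trip_cost_early (R : realType) (w : R -> R) (e L x t : R) :
  t <= x -> trip_cost w e L x t = w t + e * (x - t).
Proof.
move=> tx; rewrite /trip_cost max_l ?subr_ge0// max_r ?subr_le0//; lra.
Qed.

Lemma trip_cost_late (R : realType) (w : R -> R) (e L x t : R) :
  x <= t -> trip_cost w e L x t = w t + L * (t - x).
Proof.
move=> tx; rewrite /trip_cost max_r ?subr_le0// max_l ?subr_ge0//; lra.
Qed.

(** Reversing time exchanges earliness and lateness. The ramp after the last costliest user is
    thereby an instance of the ramp before the first one. *)
Lemma trip_cost_opp (R : realType) (w : R -> R) (e L x t : R) :
  trip_cost (w \o -%R) L e (- x) (- t) = trip_cost w e L x t.
Proof.
rewrite /trip_cost /= !opprK addrAC; congr (_ + _ * Num.max _ _ + _ * Num.max _ _).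
  by rewrite addrC.
by rewrite addrC.
Qed.

(** At a fixed exit time, a later desired time adds earliness at rate at most [e] and can only
    reduce lateness. *)
Lemma trip_cost_shift_right (R : realType) (w : R -> R) (e L x y t : R) :
  0 <= e -> 0 <= L -> y <= x ->
  trip_cost w e L x t <= trip_cost w e L y t + e * (x - y).
Proof.
move=> e0 L0 yx; have [tx|/ltW xt] := leP t x; last first.
  rewrite !trip_cost_late//; last lra.
  by have := mulr_ge0 e0 (_ : 0 <= x - y); have := mulr_ge0 L0 (_ : 0 <= x - y); lra.
rewrite trip_cost_early//; have [ty|/ltW yt] := leP t y.
  by rewrite trip_cost_early//; lra.
rewrite trip_cost_late//.
have := mulr_ge0 e0 (_ : 0 <= t - y); have := mulr_ge0 L0 (_ : 0 <= t - y); lra.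
Qed.

Lemma trip_cost_shift_left (R : realType) (w : R -> R) (e L x y t : R) :
  0 <= e -> 0 <= L -> x <= y ->
  trip_cost w e L x t <= trip_cost w e L y t + L * (y - x).
Proof.
move=> e0 L0 xy; rewrite -(trip_cost_opp w e L x) -(trip_cost_opp w e L y).
have := trip_cost_shift_right (w \o -%R) (- t) L0 e0 (_ : - y <= - x).
by rewrite lerN2 => /(_ xy); rewrite opprK [- x + y]addrC.
Qed.

Section Ramp.
Context {R : realType}.
(** Abstract form of one side of an equilibrium: [A] counts exits, bounded in rate by [mu]; [T y] is
    the exit time of user [y]; users arrive at density [lam] from [a] to [x1]. [H_le] and [H_inf]
    together make [H] the infimum of the cost of [x1]. *)
Variables (w A T : R -> R) (a x1 e L lam mu H : R).
Hypotheses (e_gt0 : 0 < e) (L_gt0 : 0 < L) (mu_gt0 : 0 < mu)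
  (mu_lam : mu < lam) (H_ge0 : 0 <= H) (a_x1 : a <= x1)
  (w_ge0 : forall t, 0 <= w t) (A_ge0 : forall t, 0 <= A t)
  (A_lip : forall s t, s <= t -> A t <= A s + mu * (t - s))
  (A_mono : forall s t, s <= t -> A s <= A t)
  (A_strict : forall s t, s < t -> (forall u, s < u < t -> 0 < w u) ->
    A s < A t)
  (A_x1 : A x1 = lam * (x1 - a))
  (A_T : forall y, a <= y < x1 -> A (T y) = lam * (y - a))
  (T_opt : forall y, a <= y < x1 ->
    forall s, trip_cost w e L y (T y) <= trip_cost w e L y s)
  (H_le : forall s, H <= trip_cost w e L x1 s)
  (H_inf : forall eps, 0 < eps -> exists s, trip_cost w e L x1 s < H + eps).

Let lam_gt0 : 0 < lam. Proof. exact: lt_trans mu_lam. Qed.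

Let T_lt_x1 y : a <= y < x1 -> T y < x1.
Proof.
move=> /[dup] ay /A_T ATy; rewrite ltNge; apply/negP => /A_mono.
by rewrite ATy A_x1 ler_pM2l//; lra.
Qed.

(** The [lam * (x1 - y)] users from [y] to [x1] all exit between [T y] and [x1], at rate at most
    [mu]. *)
Let T_lead y : a <= y < x1 -> lam * (x1 - y) <= mu * (x1 - T y).
Proof.
move=> ay; have := A_lip (ltW (T_lt_x1 ay)).
by rewrite A_x1 A_T//; lra.
Qed.

Let T_early y : a <= y < x1 -> T y <= y.
Proof.
move=> ay; have := T_lead ay => lead.
have : mu * (x1 - y) <= lam * (x1 - y).
  by case/andP: ay => _ yx1; apply: ler_wpM2r; rewrite ?subr_ge0 ltW.
by move=> /le_trans/(_ lead); rewrite ler_pM2l//; lra.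
Qed.

(* As user [y] exits early, the cost paid by [y] is [pot y + e * y]. *)
Let pot y := w (T y) - e * T y.

(** User [x] may exit at [T y], which precedes [y] and is therefore early for [x] too. *)
Let pot_le y x : a <= y -> y <= x -> x < x1 -> pot x <= pot y.
Proof.
move=> ay yx xx1; have ay' : a <= y < x1 by rewrite ay (le_lt_trans yx).
have ax' : a <= x < x1 by rewrite xx1 (le_trans ay yx).
have := T_opt ax' (T y).
have Tyx := le_trans (T_early ay') yx.
by rewrite !trip_cost_early ?T_early// /pot; lra.
Qed.

Let kap := lam / mu - 1.

Let kap_gt0 : 0 < kap.
Proof. by rewrite /kap subr_gt0 ltr_pdivlMr// mul1r. Qed.

Let T_margin x : a <= x < x1 -> T x <= x - kap * (x1 - x).
Proof.
move=> /T_lead; rewrite -ler_pdivrMl// => lead.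
have -> : x - kap * (x1 - x) = x1 - mu^-1 * (lam * (x1 - x)).
  by rewrite /kap; field; rewrite gt_eqF.
lra.
Qed.

(* A user [y] can imitate the exit of a later user [x] as long as [T x <= y];
   the margin [kap * (x1 - x)] makes this possible in finitely many steps. *)
Let pot_const y x : a <= y -> y <= x -> x < x1 -> pot x = pot y.
Proof.
move=> ay; have step z v : a <= z -> z <= v -> v < x1 -> v - kap * (x1 - v) <= z ->
    pot v = pot z.
  move=> az zv vx1 vz; apply/eqP; rewrite eq_le pot_le//=.
  have az' : a <= z < x1 by rewrite az (le_lt_trans zv).
  have av' : a <= v < x1 by rewrite vx1 (le_trans az zv).
  have Tvz : T v <= z by exact: le_trans (T_margin av') vz.
  have := T_opt az' (T v).
  by rewrite !trip_cost_early ?T_early// /pot; lra.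
(* Induction on the number of imitation steps. Moving [x] away from [x1] lengthens the step
   [kap * (x1 - x)], so a count that suffices at [x] suffices, less one, after the first step. *)
suff steps n : forall x, y <= x -> x < x1 -> x - y <= n%:R * (kap * (x1 - x)) ->
    pot x = pot y.
  move=> yx xx1; have d0 : 0 < kap * (x1 - x) by rewrite mulr_gt0 ?kap_gt0 ?subr_gt0.
  apply: (steps (Num.trunc ((x - y) / (kap * (x1 - x)))).+1) => //.
  by rewrite -ler_pdivrMr// ltW// truncnS_gt.
elim: n => [|n IH] {}x yx xx1.
  rewrite mul0r => xy; suff -> : x = y by [].
  by apply/eqP; rewrite eq_le yx -subr_le0 xy.
move=> xy; have [le|/ltW ge] := leP (x - kap * (x1 - x)) y.
  exact: step.
have d0 : 0 < kap * (x1 - x) by rewrite mulr_gt0 ?kap_gt0 ?subr_gt0.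
rewrite (step (x - kap * (x1 - x)) x) //; [|lra..].
apply: IH => //; first lra.
have : n%:R * (kap * (x1 - x)) <= n%:R * (kap * (x1 - (x - kap * (x1 - x)))).
  by apply: ler_wpM2l; rewrite ?ler0n// ler_pM2l//; lra.
by apply: le_trans; move: xy; rewrite -natr1; lra.
Qed.

(** The constant value of [pot] is identified at [x1]. It is at least [H - e * x1] because [x1]
    could exit at [T y]; it is at most that because users just before [x1] could use a nearly
    optimal exit of [x1]. *)
Let w_T y : a <= y < x1 -> w (T y) = H - e * (x1 - T y).
Proof.
move=> /andP[ay yx1]; suff : pot y = H - e * x1 by rewrite /pot; lra.
apply/eqP; rewrite eq_le; apply/andP; split; last first.
  have := H_le (T y); rewrite trip_cost_early.
    by rewrite /pot; lra.
  by apply/ltW/T_lt_x1/andP.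
apply/ler_addgt0Pr => eps eps0.
have [s sH] : exists s, trip_cost w e L x1 s < H + eps / 2.
  by apply: H_inf; rewrite divr_gt0.
(* Replacing [x1] by a user [x] costs [L * (x1 - x)] in the trip cost and [e * (x1 - x)] in [pot];
   [d] keeps the sum below [eps / 2]. *)
pose d := eps / 2 / (e + L).
have eL0 : 0 < e + L by rewrite addr_gt0.
have d0 : 0 < d by rewrite !divr_gt0.
pose x := Num.max y (x1 - d).
have yx : y <= x by rewrite le_max lexx.
have xx1 : x < x1 by rewrite gt_max yx1; lra.
have ax' : a <= x < x1 by rewrite xx1 (le_trans ay yx).
rewrite -(pot_const ay yx xx1).
have := T_opt ax' s; rewrite [X in X <= _]trip_cost_early ?T_early// => Tx.
have := trip_cost_shift_left w s (ltW e_gt0) (ltW L_gt0) (ltW xx1).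
have dd : (e + L) * (x1 - x) <= eps / 2.
  rewrite -ler_pdivlMl//; have : x1 - d <= x by rewrite le_max lexx orbT.
  by rewrite /d [_^-1 * _]mulrC; lra.
by rewrite /pot; move: sH Tx; lra.
Qed.

(** No car precedes the first user [a], and [T a] cannot lie before [x1 - H / e], where [w_T] would
    give a negative delay. *)
Lemma ramp_start : A (x1 - H / e) = 0.
Proof.
have He0 : 0 <= H / e by rewrite divr_ge0// ltW.
apply/eqP; rewrite eq_le A_ge0 andbT.
have [ax|ax] : a = x1 \/ a < x1 by move: a_x1; rewrite le_eqVlt => /predU1P.
  have /A_mono : x1 - H / e <= x1 by lra.
  by rewrite A_x1 ax subrr mulr0.
have ax' : a <= a < x1 by rewrite lexx ax.
have <- : A (T a) = 0 by rewrite A_T// subrr mulr0.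
apply: A_mono; have := w_ge0 (T a); rewrite w_T// subr_ge0.
by rewrite mulrC -ler_pdivlMr//; lra.
Qed.

(** [w_T] gives the delay at exit times only, so it remains to see that every [t] in the interval is
    one. The delay is positive there by [H_le], so [A] is strictly increasing and determines the
    time. *)
Lemma ramp_delay t : x1 - H / e < t < x1 -> w t = H - e * (x1 - t).
Proof.
have wpos u : x1 - H / e < u < x1 -> 0 < w u.
  move=> /andP[u1 u2]; have := H_le u; rewrite trip_cost_early; last exact: ltW.
  have : e * (x1 - u) < H by rewrite mulrC -ltr_pdivlMr//; lra.
  lra.
(* [y] is the user whose rank equals the number of exits up to [t]. *)
move=> /andP[lt tx1]; pose y := a + A t / lam.
have Ay : lam * (y - a) = A t.
  by rewrite /y addrC addKr; field; rewrite gt_eqF.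
have AtA : A t < A x1.
  by apply: A_strict => // u /andP[u1 u2]; apply: wpos; rewrite u2 (lt_trans lt u1).
have ay : a <= y < x1.
  apply/andP; split; first by rewrite lerDl divr_ge0// ltW.
  by move: AtA; rewrite -Ay A_x1 ltr_pM2l//; lra.
suff <- : T y = t by exact: w_T.
have ATy : A (T y) = A t by rewrite A_T.
have Ty_ge : x1 - H / e <= T y.
  have := w_ge0 (T y); rewrite w_T// subr_ge0.
  by rewrite mulrC -ler_pdivlMr//; lra.
have Ty_lt := T_lt_x1 ay.
apply/eqP; rewrite eq_le !leNgt; apply/andP; split; apply/negP => Tt.
  suff : A t < A (T y) by rewrite ATy ltxx.
  apply: A_strict => // u /andP[u1 u2].
  by apply: wpos; rewrite (lt_trans lt u1) (lt_trans u2).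
suff : A (T y) < A t by rewrite ATy ltxx.
apply: A_strict => // u /andP[u1 u2].
by apply: wpos; rewrite (le_lt_trans Ty_ge u1) (lt_trans u2).
Qed.

End Ramp.

(** * Cumulative flows *)

Lemma lipschitz_continuous (R : realType) (f : R -> R) (k : R) : 0 < k ->
  (forall x y, `|f x - f y| <= k * `|x - y|) -> continuous f.
Proof.
move=> k0 lip x; apply/cvgrPdist_le => eps eps0.
near=> y; apply: le_trans (lip x y) _.
rewrite mulrC -ler_pdivlMr//; near: y.
by apply: cvgr_dist_le; [exact: cvg_id|rewrite divr_gt0].
Unshelve. all: by end_near. Qed.

Section Integrals.
Context {R : realType}.
Notation leb := (@lebesgue_measure R).

Lemma Rintegral_itv_cc_oo (f : R -> R) (u v : R) :
  leb.-integrable `[u, v] (EFin \o f) ->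
  \int[leb]_(x in `[u, v]) f x = \int[leb]_(x in `]u, v[) f x.
Proof.
move=> fi; rewrite -Rintegral_itv_obnd_cbnd.
  rewrite -Rintegral_itv_bndo_bndc//.
  by apply: integrableS fi => //; apply: subset_itv; rewrite bnd_simp.
by apply: integrableS fi => //; apply: subset_itv; rewrite bnd_simp.
Qed.

Lemma Rintegral_itv_cst (c u v : R) : u <= v ->
  \int[leb]_(x in `]u, v[) c = c * (v - u).
Proof.
move=> uv; rewrite Rintegral_cst//= lebesgue_measure_itv/= lte_fin.
case: ifPn => [_|]; first by rewrite -EFinD.
by rewrite -leNgt => vu; rewrite (@le_anti _ _ u v) ?uv// subrr.
Qed.

Lemma cst_integrable_itv (c u v : R) : leb.-integrable `]u, v[ (EFin \o cst c).
Proof.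
apply: measurable_bounded_integrable => //.
  by rewrite /= lebesgue_measure_itv/=; case: ifP => // _; rewrite -EFinD ltry.
exact: bounded_cst.
Qed.

Lemma affine_gt0 (c b u v x : R) : 0 < c + b * u -> 0 < c + b * v ->
  u <= x <= v -> 0 < c + b * x.
Proof.
move=> cu cv /andP[ux xv]; have [b_ge0|/ltW b_le0] := leP 0 b.
  by apply: lt_le_trans cu _; rewrite lerD2l ler_wpM2l.
by apply: lt_le_trans cv _; rewrite lerD2l ler_wnM2l.
Qed.

Lemma continuous_inv_affine (k c b u v : R) :
  0 < c + b * u -> 0 < c + b * v ->
  {within `[u, v], continuous (fun x => k / (c + b * x))}.
Proof.
move=> cu cv; apply: continuous_in_subspaceT => x.
rewrite inE/= in_itv/= => /(affine_gt0 cu cv) cx.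
apply: cvgM; first exact: cvg_cst.
apply: cvgV; first by rewrite gt_eqF.
by apply: cvgD; [exact: cvg_cst|apply: cvgM; [exact: cvg_cst|exact: cvg_id]].
Qed.

Lemma Rintegral_inv_affine (k c b u v : R) : b != 0 -> u <= v ->
  0 < c + b * u -> 0 < c + b * v ->
  \int[leb]_(x in `[u, v]) (k / (c + b * x)) =
  k / b * (ln (c + b * v) - ln (c + b * u)).
Proof.
move=> b0; rewrite le_eqVlt => /predU1P[-> _ _|uv cu cv].
  by rewrite set_itv1 Rintegral_set1 subrr mulr0.
have pos x : u <= x <= v -> 0 < c + b * x by exact: affine_gt0.
have dF x : u <= x <= v ->
    is_derive x (1 : R) (fun x => k / b * ln (c + b * x)) (k / (c + b * x)).
  move=> /pos cx; have := is_derive1_ln cx => dln.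
  have daff : is_derive x (1 : R) (fun x => c + b * x) b.
    have -> : (fun x => c + b * x) = cst c + b *: (@id R) by [].
    by apply: is_derive_eq; rewrite /GRing.scale/= mulr1 add0r.
  have dcomp : is_derive x (1 : R) (@ln R \o (fun x => c + b * x)) (b / (c + b * x)).
    rewrite mulrC; exact: (@is_derive1_comp _ (@ln R) (fun x => c + b * x) x _ _ dln daff).
  have -> : (fun x => k / b * ln (c + b * x)) =
      (k / b) *: (@ln R \o (fun x => c + b * x)) by [].
  have := is_deriveZ (k / b) dcomp.
  rewrite (_ : k / b *: (b / (c + b * x)) = k / (c + b * x))//.
  rewrite /GRing.scale/=; field.
  by rewrite b0 gt_eqF.
have cF x : u <= x <= v ->
    {for x, continuous (fun x => k / b * ln (c + b * x))}.
  by move=> /dF[/derivable1_diffP/differentiable_continuous].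
rewrite /Rintegral (@continuous_FTC2 _ _ (fun x => k / b * ln (c + b * x)))//.
- by rewrite -EFinB /=; ring.
- exact: continuous_inv_affine.
- split.
  + by move=> x; rewrite in_itv/= => /andP[/ltW ux /ltW xv]; case: (dF x); rewrite ?ux.
  + by apply: cvg_at_right_filter; apply: cF; rewrite lexx ltW.
  + by apply: cvg_at_left_filter; apply: cF; rewrite lexx ltW.
- move=> x; rewrite in_itv/= => /andP[/ltW ux /ltW xv].
  by rewrite derive1E; apply: derive_val; apply: dF; rewrite ux.
Qed.

End Integrals.

Section CumulativeFlow.
Context {R : realType}.
Notation leb := (@lebesgue_measure R).
Variables (m : R -> R) (mu tA tD : R).
Hypotheses (m_meas : measurable_fun setT m) (m_ge0 : forall t, 0 <= m t)
  (m_le : forall t, m t <= mu)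
  (m_out : forall t, ~ (tA <= t <= tD) -> m t = 0).

Definition cumul (t : R) : R := \int[leb]_(s in `]-oo, t]) m s.

Lemma flow_integrable (D : set R) : measurable D -> leb.-integrable D (EFin \o m).
Proof.
move=> mD; apply: (@integrableS _ _ _ leb setT) => //.
have -> : EFin \o m = (EFin \o m) \_ `[tA, tD].
  apply/funext => t; rewrite patchE; case: ifPn => // /negP; rewrite inE/= in_itv/=.
  by move=> /m_out ->.
apply/integrable_restrict => //; rewrite setTI.
apply: measurable_bounded_integrable => //.
- by rewrite /= lebesgue_measure_itv/=; case: ifP => // _; rewrite -EFinD ltry.
- exact: measurable_funTS.
- exists mu; split; first exact: num_real.
  by move=> M muM t _ /=; rewrite ger0_norm// (le_trans (m_le t))// ltW.
Qed.

Lemma cumul_sub s t : s <= t ->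
  cumul t = cumul s + \int[leb]_(x in `]s, t[) m x.
Proof.
move=> st; rewrite /cumul [in RHS]Rintegral_itv_bndo_bndc;
  last by apply: flow_integrable; exact: measurable_itv.
rewrite -(@Rintegral_itvB _ _ -oo%O (BRight t) s) ?bnd_simp//.
  by rewrite addrC subrK.
exact: flow_integrable.
Qed.

Lemma cumul_ge0 t : 0 <= cumul t.
Proof. by apply: Rintegral_ge0. Qed.

Lemma cumul_mono s t : s <= t -> cumul s <= cumul t.
Proof. by move=> st; rewrite (cumul_sub st) lerDl Rintegral_ge0. Qed.

Lemma cumul_le s t c : s <= t -> (forall u, s < u < t -> m u <= c) ->
  cumul t <= cumul s + c * (t - s).
Proof.
move=> st mc; rewrite (cumul_sub st) lerD2l -Rintegral_itv_cst//.
apply: le_Rintegral => //; first exact: flow_integrable.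
exact: cst_integrable_itv.
Qed.

Lemma cumul_lip s t : s <= t -> cumul t <= cumul s + mu * (t - s).
Proof. by move=> st; apply: cumul_le. Qed.

(** A zero increment would make [m] vanish almost everywhere on an interval of positive length. *)
Lemma cumul_strict s t : s < t -> (forall u, s < u < t -> 0 < m u) ->
  cumul s < cumul t.
Proof.
move=> st mpos; rewrite (cumul_sub (ltW st)) ltrDl lt_neqAle Rintegral_ge0// andbT.
apply/eqP => int0.
have /integrableP[mst _] := flow_integrable (measurable_itv `]s, t[).
have int0' : (\int[leb]_(x in `]s, t[) `|(m x)%:E| = 0)%E.
  under eq_integral do rewrite /= ger0_norm//.
  rewrite -[LHS]fineK; last exact/integrable_fin_num/flow_integrable.
  by rewrite -[fine _]/(Rintegral _ _ _) -int0.
have [N [mN N0 sN]] := (ae_eq_integral_abs leb (measurable_itv `]s, t[) mst).1 int0'.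
have stN : `]s, t[ `<=` N.
  move=> u us; apply: sN => /= mu0.
  have := mpos u us; have := mu0 us => -[->]; by rewrite ltxx.
have := le_measure leb _ _ stN; rewrite !inE => /(_ (measurable_itv _) mN).
move: N0 => /= ->; rewrite lebesgue_measure_itv/= lte_fin st -EFinD lee_fin.
by rewrite leNgt subr_gt0 st.
Qed.

Lemma cumul_end t : tD <= t -> cumul t = cumul tD.
Proof.
move=> Dt; apply/eqP; rewrite eq_le (cumul_mono Dt) andbT.
have := @cumul_le tD t 0 Dt; rewrite mul0r addr0; apply => u /andP[Du _].
by rewrite m_out// => /andP[_]; rewrite leNgt Du.
Qed.

Lemma cumul_start t : t <= tA -> cumul t = 0.
Proof.
move=> tA'; rewrite /cumul -Rintegral_itv_bndo_bndc; last exact: flow_integrable.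
rewrite (@eq_Rintegral _ _ _ _ _ (cst 0)) ?Rintegral_cst ?mul0r// => u.
rewrite inE/= in_itv/= => ut; apply: m_out => /andP[Au _].
by have := lt_le_trans ut tA'; rewrite ltNge Au.
Qed.

Lemma cumul_total : tA <= tD -> cumul tD = \int[leb]_(t in `[tA, tD]) m t.
Proof.
move=> AD; rewrite (cumul_sub AD) cumul_start// add0r Rintegral_itv_cc_oo//.
exact: flow_integrable.
Qed.

Lemma cumul_cst s t c : s <= t -> (forall u, s < u < t -> m u = c) ->
  cumul t = cumul s + c * (t - s).
Proof.
move=> st mc; rewrite (cumul_sub st) -Rintegral_itv_cst//; congr (_ + _).
by apply: eq_Rintegral => u; rewrite inE/= in_itv/= => /mc.
Qed.

Lemma cumul_continuous : continuous cumul.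
Proof.
have mu_ge0 : 0 <= mu by exact: le_trans (m_le 0).
(* Adding 1 gives [lipschitz_continuous] a positive constant even when [mu] is zero. *)
have lip x y : `|cumul x - cumul y| <= (mu + 1) * `|x - y|.
  wlog yx : x y / y <= x.
    move=> H; have [|/ltW] := leP y x; first exact: H.
    by move=> /H; rewrite distrC [`|y - x|]distrC.
  rewrite !ger0_norm ?subr_ge0 ?cumul_mono// lerBlDl.
  apply: le_trans (cumul_lip yx) _; rewrite lerD2l ler_wpM2r ?subr_ge0//.
  by rewrite lerDl.
by apply: (lipschitz_continuous _ lip); rewrite ltr_wpDl.
Qed.

(** A delay linear in time makes the outflow a constant over an affine function; this is the source
    of the logarithm in the revenue. *)
Lemma cumul_affine s t k c b : b != 0 -> s <= t -> 0 < c + b * s ->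
  0 < c + b * t -> (forall u, s < u < t -> m u = k / (c + b * u)) ->
  cumul t = cumul s + k / b * (ln (c + b * t) - ln (c + b * s)).
Proof.
move=> b0 st cs ct mE; rewrite (cumul_sub st); congr (_ + _).
rewrite -Rintegral_inv_affine// Rintegral_itv_cc_oo.
  by apply: eq_Rintegral => u; rewrite inE/= in_itv/= => /mE.
apply: continuous_compact_integrable; first exact: segment_compact.
exact: continuous_inv_affine.
Qed.

End CumulativeFlow.

(** * The triangular diagram and the minimal cost of a user *)

Section Diagram.
Context {R : realType}.
Variable P : urban_model R.
Hypotheses (mu_f_gt0 : 0 < mu_f P) (n_c_gt0 : 0 < n_c P) (n_cj : n_c P < n_j P)
  (trip_length_gt0 : 0 < trip_length P).

(** The flow on the congested branch as a function of the delay [w]: eliminating the accumulation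
    between the diagram and the delay formula cancels [n_c]. *)
Definition outflow (w : R) : R := n_j P / (n_j P / mu_f P + w).

Lemma n_j_gt0 : 0 < n_j P. Proof. exact: lt_trans n_cj. Qed.

Let n_jc_gt0 : 0 < n_j P - n_c P. Proof. by rewrite subr_gt0. Qed.

Lemma outflow_den_gt0 w : 0 <= w -> 0 < n_j P / mu_f P + w.
Proof. by move=> w0; rewrite ltr_wpDr// divr_gt0// n_j_gt0. Qed.

Lemma outflow_gt0 w : 0 <= w -> 0 < outflow w.
Proof. by move=> w0; rewrite divr_gt0 ?outflow_den_gt0 ?n_j_gt0. Qed.

Lemma outflow_anti v w : 0 <= v -> v <= w -> outflow w <= outflow v.
Proof.
move=> v0 vw; rewrite ler_pM2l ?n_j_gt0// lef_pV2 ?posrE ?outflow_den_gt0//.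
  by rewrite lerD2l.
exact: le_trans vw.
Qed.

Lemma outflow0 : outflow 0 = mu_f P.
Proof.
by rewrite /outflow addr0; field; rewrite !gt_eqF// n_j_gt0.
Qed.

Lemma outflow_le_mu w : 0 <= w -> outflow w <= mu_f P.
Proof. by move=> w0; rewrite -outflow0 outflow_anti. Qed.

(** The two lines cross at [n_c]. In this form nonnegativity and measurability follow from those of
    each line. *)
Lemma mfd_minE n : mfd P n =
  Num.min (mu_f P * (n / n_c P)) (mu_f P * ((n_j P - n) / (n_j P - n_c P))).
Proof.
have key : (n / n_c P <= (n_j P - n) / (n_j P - n_c P)) = (n <= n_c P).
  rewrite ler_pdivrMr// mulrAC ler_pdivlMr//.
  rewrite -subr_ge0 [X in 0 <= X](_ : _ = n_j P * (n_c P - n)); last by ring.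
  by rewrite pmulr_rge0 ?n_j_gt0// subr_ge0.
rewrite /mfd; case: ifPn => nn.
  by rewrite min_l// ler_pM2l// key.
rewrite min_r// ler_pM2l// ltW// ltNge key//.
Qed.

Lemma mfd_congested n : n_c P <= n ->
  mfd P n = mu_f P * ((n_j P - n) / (n_j P - n_c P)).
Proof.
rewrite /mfd; case: ifPn => // nn nc.
have -> : n = n_c P by apply: le_anti; rewrite nn.
by rewrite !divff ?gt_eqF.
Qed.

Lemma mfd0 : mfd P 0 = 0.
Proof. by rewrite /mfd ltW// mul0r mulr0. Qed.

Lemma mfd_ge0 n : 0 <= n < n_j P -> 0 <= mfd P n.
Proof.
move=> /andP[n0 nj]; have := ltW mu_f_gt0 => mu0.
by rewrite mfd_minE le_min !mulr_ge0//= ?invr_ge0 ?subr_ge0 ltW.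
Qed.

Lemma mfd_le n : mfd P n <= mu_f P.
Proof.
rewrite /mfd; case: ifPn => nn; rewrite -[leRHS]mulr1 ler_pM2l//.
  by rewrite ler_pdivrMr// mul1r.
by rewrite ler_pdivrMr// mul1r lerD2l lerN2 ltW// ltNge.
Qed.

Lemma delay_congested n : n_c P <= n < n_j P ->
  delay P n = n_j P * (n - n_c P) / (mu_f P * (n_j P - n)).
Proof.
move=> /andP[nn nj].
have n0 : 0 < n by exact: lt_le_trans nn.
rewrite delayE ?gt_eqF// mfd_congested//; field.
by rewrite !gt_eqF// ?subr_gt0.
Qed.

Lemma delay_ge0 n : 0 <= n < n_j P -> 0 <= delay P n.
Proof.
move=> /andP[n0 nj]; have [nc|/ltW cn] := leP n (n_c P).
  by rewrite delay_free_flow// n0.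
rewrite delay_congested ?cn// divr_ge0// mulr_ge0 ?subr_ge0//; apply: ltW => //.
exact: n_j_gt0.
Qed.

Lemma mfd_congested_outflow n : n_c P <= n < n_j P ->
  mfd P n = outflow (delay P n).
Proof.
move=> /andP[cn nj]; rewrite delay_congested ?cn// mfd_congested// /outflow.
field; rewrite !gt_eqF ?subr_gt0 ?n_j_gt0//=.
rewrite [X in 0 < X](_ : _ = n_j P * (n_j P - n_c P)) ?mulr_gt0 ?n_j_gt0//; ring.
Qed.

Lemma mfd_delay_outflow n : 0 <= n < n_j P -> 0 < delay P n ->
  mfd P n = outflow (delay P n).
Proof.
move=> /andP[n0 nj]; have [nc|/ltW cn] := leP n (n_c P).
  by rewrite delay_free_flow ?n0// ltxx.
by move=> _; rewrite mfd_congested_outflow ?cn.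
Qed.

(** At zero delay the accumulation may lie anywhere on the free-flow branch, so only an inequality
    survives there. *)
Lemma mfd_le_outflow n : 0 <= n < n_j P -> mfd P n <= outflow (delay P n).
Proof.
move=> nj; have := delay_ge0 nj; rewrite le_eqVlt => /predU1P[<-|/mfd_delay_outflow->//].
by rewrite outflow0 mfd_le.
Qed.

End Diagram.

Lemma measurable_mfd (R : realType) (P : urban_model R) (f : R -> R) :
  0 < mu_f P -> 0 < n_c P -> n_c P < n_j P ->
  measurable_fun setT f -> measurable_fun setT (fun t => mfd P (f t)).
Proof.
move=> mu0 nc0 ncj mf; under eq_fun do rewrite mfd_minE//.
apply: measurable_minr; apply: measurable_funM => //; apply: measurable_funM => //.
by apply: measurable_funB.
Qed.

Section MinCost.
Context {R : realType}.
Variables (w : R -> R) (e L : R).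
Hypotheses (w_ge0 : forall t, 0 <= w t) (e_gt0 : 0 < e) (L_gt0 : 0 < L).

(** An infimum, since [w] has no regularity here and a best exit time need not exist. *)
Definition min_cost (x : R) : R := inf (range (trip_cost w e L x)).

Lemma trip_cost_ge_delay x t : w t <= trip_cost w e L x t.
Proof.
have max_ge0 u : 0 <= Num.max u (0 : R) by rewrite le_max lexx orbT.
by rewrite /trip_cost -addrA lerDl addr_ge0// mulr_ge0// ltW.
Qed.

Lemma trip_cost_ge0 x t : 0 <= trip_cost w e L x t.
Proof. exact: le_trans (trip_cost_ge_delay x t). Qed.

Let has_inf_cost x : has_inf (range (trip_cost w e L x)).
Proof.
split; first by exists (trip_cost w e L x x); exists x.
by exists 0 => _ [t _ <-]; exact: trip_cost_ge0.
Qed.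

Lemma min_cost_le x t : min_cost x <= trip_cost w e L x t.
Proof. by apply: ge_inf; [case: (has_inf_cost x)|exists t]. Qed.

Lemma min_cost_ge x c : (forall t, c <= trip_cost w e L x t) -> c <= min_cost x.
Proof.
by move=> cle; apply: lb_le_inf; [case: (has_inf_cost x)|move=> _ [t _ <-]].
Qed.

Lemma min_cost_adherent x eps : 0 < eps ->
  exists t, trip_cost w e L x t < min_cost x + eps.
Proof.
by move=> /inf_adherent/(_ (has_inf_cost x))[_ [t _ <-] lt]; exists t.
Qed.

Lemma min_cost_attained x t :
  (forall s, trip_cost w e L x t <= trip_cost w e L x s) ->
  min_cost x = trip_cost w e L x t.
Proof.
by move=> opt; apply: le_anti; rewrite min_cost_le min_cost_ge.
Qed.

Lemma min_cost_ge0 x : 0 <= min_cost x.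
Proof. by apply: min_cost_ge => t; exact: trip_cost_ge0. Qed.

Lemma min_cost_le_delay x : min_cost x <= w x.
Proof.
by have := min_cost_le x x; rewrite trip_cost_early// subrr mulr0 addr0.
Qed.

Lemma min_cost_shift_right x y : y <= x -> min_cost x <= min_cost y + e * (x - y).
Proof.
move=> yx; rewrite -lerBlDr; apply: min_cost_ge => t; rewrite lerBlDr.
apply: le_trans (min_cost_le x t) _.
by apply: trip_cost_shift_right; rewrite // ltW.
Qed.

Lemma min_cost_shift_left x y : x <= y -> min_cost x <= min_cost y + L * (y - x).
Proof.
move=> xy; rewrite -lerBlDr; apply: min_cost_ge => t; rewrite lerBlDr.
apply: le_trans (min_cost_le x t) _.
by apply: trip_cost_shift_left; rewrite // ltW.
Qed.

(** Each cost at a fixed exit time is Lipschitz in the desired time, with a constant independent of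
    the exit time; the infimum inherits this however irregular [w] is. *)
Lemma min_cost_lip x y : `|min_cost x - min_cost y| <= (e + L) * `|x - y|.
Proof.
wlog yx : x y / y <= x.
  move=> H; have [|/ltW] := leP y x; first exact: H.
  by move=> /H; rewrite distrC [`|y - x|]distrC.
have xy0 : 0 <= x - y by rewrite subr_ge0.
have := min_cost_shift_right yx; have := min_cost_shift_left yx.
have := mulr_ge0 (ltW e_gt0) xy0; have := mulr_ge0 (ltW L_gt0) xy0.
by rewrite [`|x - y|]ger0_norm// ler_norml => *; apply/andP; split; lra.
Qed.

Lemma min_cost_continuous : continuous min_cost.
Proof.
by apply: (lipschitz_continuous _ min_cost_lip); rewrite addr_gt0.
Qed.

End MinCost.

(** * Structure of an equilibrium *)

(** The level set in the segment is compact and nonempty, so the identity attains its maximum on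
    it. *)
Lemma level_greatest (R : realType) (f : R -> R) (p q H : R) :
  continuous f -> (exists2 x, p <= x <= q & f x = H) ->
  exists a, [/\ p <= a <= q, f a = H & forall x, a < x <= q -> f x <> H].
Proof.
move=> cf [x xpq fx].
have S0 : (`[p, q] `&` f @^-1` [set H]) !=set0 by exists x; split => //=; rewrite in_itv.
have cS : compact (`[p, q] `&` f @^-1` [set H]).
  apply: compact_closedI; first exact: segment_compact.
  by apply: closed_comp => //; exact: closed_eq.
have [|a] := @compact_EVT_max _ _ (@id R) _ S0 cS.
  by apply: continuous_subspaceT => ?; exact: cvg_id.
rewrite inE/= in_itv/= => -[apq fa] amax; exists a; split => // y /andP[ay yq] fy.
suff : y <= a by rewrite leNgt ay.
apply: amax; rewrite inE/= in_itv/=.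
by split => //; rewrite yq andbT; case/andP: apq => pa _; rewrite (le_trans pa)// ltW.
Qed.

Lemma level_least (R : realType) (f : R -> R) (p q H : R) :
  continuous f -> (exists2 x, p <= x <= q & f x = H) ->
  exists a, [/\ p <= a <= q, f a = H & forall x, p <= x < a -> f x <> H].
Proof.
move=> cf [x /andP[px xq] fx].
have [||a [/andP[qa ap] fa amax]] := @level_greatest R (f \o -%R) (- q) (- p) H.
- by move=> y; apply: continuous_comp; [exact: opp_continuous|exact: cf].
- by exists (- x); rewrite /= ?opprK// !lerN2 xq.
- exists (- a); split => //; first by rewrite lerNr ap lerNl.
  move=> y /andP[py ya]; have := amax (- y); rewrite /= opprK; apply.
  by rewrite ltrNr ya lerN2.
Qed.

Section RampMass.
Context {R : realType}.
Variables (P : urban_model R) (m : R -> R) (mu tA tD : R).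
Hypotheses (mu_f_gt0 : 0 < mu_f P) (n_c_gt0 : 0 < n_c P) (n_cj : n_c P < n_j P)
  (m_meas : measurable_fun setT m) (m_ge0 : forall t, 0 <= m t)
  (m_le : forall t, m t <= mu) (m_out : forall t, ~ (tA <= t <= tD) -> m t = 0).

(* Mass of cars exiting while the delay moves between [0] and [c] at slope [s]. *)
Definition ramp_mass (s c : R) : R :=
  n_j P / s * ln (1 + c * mu_f P / n_j P).

Let ln_ratio (c : R) : 0 <= c ->
  ln (n_j P / mu_f P + c) - ln (n_j P / mu_f P) = ln (1 + c * mu_f P / n_j P).
Proof.
move=> c0; have k0 := outflow_den_gt0 mu_f_gt0 n_c_gt0 n_cj.
have k00 : 0 < n_j P / mu_f P by have := k0 0 (lexx _); rewrite addr0.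
rewrite -ln_div ?posrE ?k0//; congr ln; field.
by rewrite !gt_eqF// (n_j_gt0 n_c_gt0).
Qed.

Let divK (c s : R) : 0 < s -> s * (c / s) = c.
Proof. by move=> s0; rewrite mulrC divfK ?gt_eqF. Qed.

Lemma cumul_ramp_up (x c s : R) : 0 < s -> 0 <= c ->
  (forall u, x - c / s < u < x -> m u = outflow P (c - s * (x - u))) ->
  cumul m x = cumul m (x - c / s) + ramp_mass s c.
Proof.
move=> s0 c0 mE; have k0 := outflow_den_gt0 mu_f_gt0 n_c_gt0 n_cj.
rewrite (@cumul_affine _ m mu tA tD m_meas m_ge0 m_le m_out
  (x - c / s) x (n_j P) (n_j P / mu_f P + c - s * x) s).
- rewrite /ramp_mass -ln_ratio//; congr (_ + _ * (ln _ - ln _)); first by ring.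
  by rewrite mulrBr divK//; ring.
- by rewrite gt_eqF.
- by rewrite lerBlDr lerDl divr_ge0// ltW.
- by rewrite mulrBr divK//; have := k0 0 (lexx _); lra.
- by have := k0 c c0; lra.
- by move=> u /mE ->; rewrite /outflow; congr (_ / _); ring.
Qed.

Lemma cumul_ramp_down (x c s : R) : 0 < s -> 0 <= c ->
  (forall u, x < u < x + c / s -> m u = outflow P (c - s * (u - x))) ->
  cumul m (x + c / s) = cumul m x + ramp_mass s c.
Proof.
move=> s0 c0 mE; have k0 := outflow_den_gt0 mu_f_gt0 n_c_gt0 n_cj.
rewrite (@cumul_affine _ m mu tA tD m_meas m_ge0 m_le m_out
  x (x + c / s) (n_j P) (n_j P / mu_f P + c + s * x) (- s)).
- rewrite /ramp_mass -ln_ratio// invrN mulrN mulNr -mulrN opprB.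
  congr (_ + _ * (ln _ - ln _)); first by ring.
  by rewrite mulNr mulrDr divK//; ring.
- by rewrite oppr_eq0 gt_eqF.
- by rewrite lerDl divr_ge0// ltW.
- by have := k0 c c0; lra.
- by rewrite mulNr mulrDr divK//; have := k0 0 (lexx _); lra.
- by move=> u /mE ->; rewrite /outflow; congr (_ / _); ring.
Qed.

End RampMass.

Section Equilibrium.
Context {R : realType}.
Notation leb := (@lebesgue_measure R).
Variables (P : urban_model R) (tau : R) (E : @outcome R).
Hypotheses (Lambda_gt0 : 0 < Lambda P) (t12 : t1 P < t2 P)
  (mu_f_gt0 : 0 < mu_f P) (n_c_gt0 : 0 < n_c P) (n_cj : n_c P < n_j P)
  (trip_length_gt0 : 0 < trip_length P)
  (early_gt0 : 0 < early P) (late_gt0 : 0 < late P)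
  (mu_f_lambda : mu_f P < lambda P) (tau_le : tau <= z_T P - z_C P)
  (eqE : equilibrium P (static_toll tau) E).

Let w := wait P E.
Let m t := mfd P (accum E t).
Let A := cumul m.
Let r := car_rate E.
Let T := exit_time E.
Let h := min_cost w (early P) (late P).
Let cost := trip_cost w (early P) (late P).
(** The delay and schedule cost at which driving and transit cost the same. *)
Let K := z_T P - z_C P - tau.
Let driver : set R := [set x | has_car P E x].
Let exited t : set R := [set x | has_car P E x /\ T x <= t].
(** Cumulative car demand by desired exit time, to be balanced against the cumulative exits [A]. *)
Let G (y : R) := \int[leb]_(x in `[t1 P, y]) r x.

Let K_ge0 : 0 <= K. Proof. by rewrite subr_ge0. Qed.

Let w_ge0 t : 0 <= w t.
Proof. exact/delay_ge0/(accum_range eqE). Qed.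

Let m_ge0 t : 0 <= m t.
Proof. exact/mfd_ge0/(accum_range eqE). Qed.

Let m_le t : m t <= mu_f P.
Proof. exact: mfd_le. Qed.

Let m_meas : measurable_fun setT m.
Proof. by apply: measurable_mfd => //; exact: accum_measurable eqE. Qed.

Let m_out t : ~ (t_A E <= t <= t_D E) -> m t = 0.
Proof. by move=> /(accum_outside eqE) nt; rewrite /m nt mfd0. Qed.

Let m_congested t : 0 < w t -> m t = outflow P (w t).
Proof. move=> wt; exact: (mfd_delay_outflow _ _ _ _ (accum_range eqE t) wt). Qed.

Let m_pos t : 0 < w t -> 0 < m t.
Proof. by move=> wt; rewrite m_congested// outflow_gt0. Qed.

Let car_costE t x : car_cost P w (static_toll tau) t x = z_C P + cost x t + tau.
Proof. by rewrite /car_cost /cost /trip_cost /static_toll !addrA. Qed.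

Let driver_opt x : driver x -> forall s, cost x (T x) <= cost x s.
Proof.
move=> /(car_optimal eqE)[opt _] s; have := opt s.
by rewrite -/w !car_costE lerD2r lerD2l.
Qed.

Let driver_cost x : driver x -> h x = cost x (T x).
Proof. by move=> /driver_opt; exact: min_cost_attained. Qed.

Let driver_le_K x : driver x -> h x <= K.
Proof.
move=> dx; rewrite driver_cost//.
by have [_] := car_optimal eqE dx; rewrite -/w car_costE /K; lra.
Qed.

Let transit_ge_K x : has_transit P E x -> K <= h x.
Proof.
move=> tx; apply: min_cost_ge => // t.
by have := transit_optimal eqE tx t; rewrite -/w car_costE /K -/cost; lra.
Qed.

Let exit_rate t : \int[leb]_(x in exited t) r x = A t.
Proof. exact: exit_flow eqE t. Qed.

Let driver_measurable : measurable driver.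
Proof.
have -> : driver = `[t1 P, t2 P] `&` r @^-1` `]0, +oo[.
  apply/seteqP; split => x; rewrite /driver /has_car /desired /=.
    by rewrite !in_itv/= andbT.
  by rewrite !in_itv/= andbT.
exact: (car_rate_measurable eqE).
Qed.

Let r_ge0 x : t1 P <= x <= t2 P -> 0 <= r x.
Proof. by move=> /(car_rate_range eqE)/andP[]. Qed.

Let r_integrable (S : set R) : measurable S -> S `<=` `[t1 P, t2 P] ->
  leb.-integrable S (EFin \o r).
Proof.
move=> mS SD; apply: (@integrableS _ _ _ leb `[t1 P, t2 P]) => //.
apply: measurable_bounded_integrable => //.
- by rewrite /= lebesgue_measure_itv/=; case: ifP => // _; rewrite -EFinD ltry.
- exact: car_rate_measurable eqE.
- exists (lambda P); split; first exact: num_real.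
  move=> M lM x /=; rewrite in_itv/= => xt.
  have /andP[r0 rl] := car_rate_range eqE xt.
  by rewrite ger0_norm// (le_trans rl)// ltW.
Qed.

Let driver_sub x : driver x -> t1 P <= x <= t2 P. Proof. by case. Qed.

Let mass_mono (S S' : set R) : measurable S -> measurable S' ->
  S `<=` S' -> S' `<=` driver ->
  \int[leb]_(x in S) r x <= \int[leb]_(x in S') r x.
Proof.
move=> mS mS' SS' S'd.
have S'D : S' `<=` `[t1 P, t2 P].
  by move=> x /S'd/driver_sub; rewrite /= in_itv.
have iS' := r_integrable mS' S'D.
rewrite -(setDUK SS') Rintegral_setU//; last 3 first.
- exact: measurableD.
- by rewrite setDUK.
- by apply/disj_setPS => x [Sx []].
rewrite lerDl; apply: Rintegral_ge0 => x [/S'D]/=.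
by rewrite in_itv/= => /r_ge0.
Qed.

(** The exit time is not assumed measurable, but the exit order makes this set the trace on [driver]
    of a downward closed set, which is an interval. *)
Let exited_measurable t : measurable (exited t).
Proof.
have -> : exited t = driver `&` [set x | exists2 y, exited t y & x <= y].
  apply/seteqP; split => [x [dx Txt]|x [dx [y [dy Tyt] xy]]].
    by split => //; exists x.
  by split => //; exact: le_trans (exit_order eqE dx dy xy) Tyt.
apply: measurableI => //; apply: is_interval_measurable.
move=> x y _ [z ez yz] v /andP[_ vy]; exists z => //.
exact: le_trans vy yz.
Qed.

Let exited_sub t : exited t `<=` driver. Proof. by move=> x []. Qed.

Let upto_measurable y : measurable (driver `&` `[t1 P, y]).
Proof. exact: measurableI. Qed.

Let G_driver y : y <= t2 P -> G y = \int[leb]_(x in driver `&` `[t1 P, y]) r x.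
Proof.
move=> yt; rewrite setIC Rintegral_mkcondr; apply: eq_Rintegral => x.
rewrite inE/= in_itv/= => /andP[t1x xy]; rewrite patchE.
case: ifPn => // /negP; rewrite inE => ndx.
have xt : t1 P <= x <= t2 P by rewrite t1x (le_trans xy).
apply/eqP; rewrite eq_le r_ge0// andbT leNgt; apply/negP => rx.
by apply: ndx.
Qed.

(** Dropping the endpoint serves [cumul_maximizer], where user [x0] itself might exit after [x0]. *)
Let G_drivero y : y <= t2 P -> G y = \int[leb]_(x in driver `&` `[t1 P, y[) r x.
Proof.
move=> yt; rewrite /G -Rintegral_itv_bndo_bndc; last first.
  apply: r_integrable => // x /=; rewrite !in_itv/= => /andP[-> /ltW xy].
  exact: le_trans xy yt.
rewrite setIC Rintegral_mkcondr; apply: eq_Rintegral => x.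
rewrite inE/= in_itv/= => /andP[t1x xy]; rewrite patchE.
case: ifPn => // /negP; rewrite inE => ndx.
have xt : t1 P <= x <= t2 P by rewrite t1x (le_trans (ltW xy)).
apply/eqP; rewrite eq_le r_ge0// andbT leNgt; apply/negP => rx.
by apply: ndx.
Qed.

Let G_sub x y c : t1 P <= x -> x <= y -> y <= t2 P ->
  (forall u, x < u < y -> r u = c) -> G y = G x + c * (y - x).
Proof.
move=> t1x xy yt rc.
have ri : leb.-integrable `[t1 P, y] (EFin \o r).
  apply: r_integrable => // u /=; rewrite !in_itv/= => /andP[-> uy].
  exact: le_trans uy yt.
rewrite /G -Rintegral_itv_cst//.
have -> : \int[leb]_(u in `]x, y[) c = \int[leb]_(u in `]x, y[) r u.
  by apply: eq_Rintegral => u; rewrite inE/= in_itv/= => /rc.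
rewrite Rintegral_itv_bndo_bndc; last first.
  apply: integrableS ri => //; apply: subset_itv; rewrite bnd_simp//.
by rewrite -(@Rintegral_itvB _ _ (BLeft (t1 P)) (BRight y) x) ?bnd_simp// addrC subrK.
Qed.

Let A_lip s t : s <= t -> A t <= A s + mu_f P * (t - s).
Proof. exact: (cumul_lip m_meas m_ge0 m_le m_out). Qed.

Let A_mono s t : s <= t -> A s <= A t.
Proof. exact: (cumul_mono m_meas m_ge0 m_le m_out). Qed.

Let A_strict s t : s < t -> (forall u, s < u < t -> 0 < w u) -> A s < A t.
Proof.
move=> st wpos; apply: (cumul_strict m_meas m_ge0 m_le m_out st) => u /wpos.
exact: m_pos.
Qed.

(** By the exit order, drivers up to [y] are out at [T y], and whoever is out strictly before [T y]
    desires an exit no later than [y]. Ties at [T y] carry no mass because [A] is Lipschitz. *)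
Let A_T y : driver y -> A (T y) = G y.
Proof.
move=> dy; have /andP[t1y yt2] := driver_sub dy.
apply: le_anti; apply/andP; split; last first.
  rewrite G_driver// -exit_rate; apply: mass_mono => //.
  move=> x [dx] /=; rewrite in_itv/= => /andP[_ xy]; split => //.
  exact: (exit_order eqE dx dy xy).
apply/ler_addgt0Pr => eps eps0.
pose d := eps / mu_f P; have d0 : 0 < d by rewrite divr_gt0.
have le1 : A (T y - d) <= G y.
  rewrite G_driver// -exit_rate; apply: mass_mono => //.
  move=> x [dx Txy]; split => //=; rewrite in_itv/=.
  have /andP[-> _] := driver_sub dx; rewrite /= leNgt; apply/negP => /ltW yx.
  have := le_trans (exit_order eqE dy dx yx) Txy.
  by rewrite leNgt ltrBlDr ltrDl d0.
have : T y - d <= T y by rewrite lerBlDr lerDl ltW.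
move=> /A_lip; rewrite subKr.
rewrite (_ : mu_f P * d = eps); last by rewrite /d mulrC divfK ?gt_eqF.
by move=> /le_trans; apply; rewrite lerD2r.
Qed.

Let A_end t : t_D E <= t -> A t = G (t2 P).
Proof.
move=> Dt; rewrite -exit_rate G_driver//; congr (Rintegral _ _ _).
apply/seteqP; split => [x [dx Tx]|x [dx _]].
  by split => //=; rewrite in_itv/=; exact: driver_sub.
split => //; have /andP[_ TD] := exit_time_range eqE dx.
exact: le_trans TD Dt.
Qed.

Lemma revenue_total : revenue P tau E = tau * A (t_D E).
Proof.
rewrite /revenue; congr (_ * _); symmetry.
apply: (cumul_total m_meas m_ge0 m_le m_out).
exact: exit_interval eqE.
Qed.

Let h_lip x y : `|h x - h y| <= (early P + late P) * `|x - y|.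
Proof. exact: min_cost_lip. Qed.

(* Otherwise the delay exceeds [K] on a neighbourhood of [x], where cars
   nevertheless exit. *)
Let h_le_K x : t1 P <= x <= t2 P -> h x <= K.
Proof.
move=> xt; rewrite leNgt; apply/negP => Kh.
pose eL := early P + late P.
have eL0 : 0 < eL by rewrite addr_gt0.
(* Within [d] of [x], the Lipschitz bound lets [h] lose at most half of its excess over [K], and the
   delay is at least [h]. *)
pose d := (h x - K) / 2 / eL.
have d0 : 0 < d by rewrite !divr_gt0// subr_gt0.
have wK u : x - d <= u <= x + d -> K < w u.
  move=> ud; apply: lt_le_trans (min_cost_le_delay w_ge0 early_gt0 late_gt0 u).
  rewrite -/h; have xu : `|x - u| <= d by rewrite distrC ler_distl.
  have := h_lip x u; rewrite -/eL.
  have : eL * `|x - u| <= (h x - K) / 2 by rewrite -ler_pdivlMl// mulrC.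
  move=> h1 h2; have := le_trans (ler_norm _) (le_trans h2 h1).
  lra.
have xd : x - d < x + d by rewrite ltrD2l; lra.
have : A (x - d) < A (x + d).
  apply: A_strict => // u /andP[u1 u2].
  by rewrite (le_lt_trans K_ge0)// wK// !ltW.
rewrite ltNge => /negP; apply; rewrite -!exit_rate; apply: mass_mono => //.
move=> y [dy Ty]; split => //; rewrite leNgt; apply/negP => yT.
have : K < w (T y) by rewrite wK// Ty ltW.
apply/negP; rewrite -leNgt; apply: le_trans (driver_le_K dy).
by rewrite driver_cost//; exact: trip_cost_ge_delay.
Qed.

Let indifferent_h x : indifferent P tau E x -> h x = K.
Proof.
move=> [[t tE] tle]; apply: le_anti; apply/andP; split.
  apply: le_trans (min_cost_le w_ge0 early_gt0 late_gt0 x t) _.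
  by move: tE; rewrite -/w car_costE /K -/cost; lra.
apply: min_cost_ge => // s.
by have := tle s; rewrite -/w car_costE /K -/cost; lra.
Qed.

Section Maximizer.
Variable x0 : R.
Hypotheses (x0_desired : t1 P <= x0 <= t2 P)
  (x0_max : forall x, t1 P <= x <= t2 P -> h x <= h x0).

Let cost_x0 t : h x0 <= cost x0 t.
Proof. exact: min_cost_le. Qed.

(** If a driver [x > x0] exited by [x0], then [x0] could take the same exit and pay
    [early * (x - x0)] less than [x], against maximality. A driver before [x0] exiting after it is
    excluded likewise with [late]. *)
Lemma cumul_maximizer : A x0 = G x0.
Proof.
have /andP[t1x0 x0t2] := x0_desired.
apply: le_anti; apply/andP; split.
  rewrite G_driver// -exit_rate; apply: mass_mono => //.
  move=> x [dx Tx]; split => //=; rewrite in_itv/=.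
  have xt := driver_sub dx; have /andP[-> _] := xt.
  rewrite /= leNgt; apply/negP => x0x.
  have := x0_max xt; have := cost_x0 (T x); rewrite (driver_cost dx).
  rewrite /cost !trip_cost_early//; last by rewrite (le_trans Tx)// ltW.
  have : 0 < early P * (x - x0) by rewrite mulr_gt0// subr_gt0.
  lra.
rewrite G_drivero// -exit_rate; apply: mass_mono => //.
  exact: measurableI.
move=> x [dx] /=; rewrite in_itv/= => /andP[_ xx0]; split => //.
rewrite leNgt; apply/negP => Tx.
have := x0_max (driver_sub dx); have := cost_x0 (T x); rewrite (driver_cost dx).
have xT : x <= T x by rewrite (le_trans (ltW xx0))// ltW.
rewrite /cost !trip_cost_late ?(ltW Tx)//.
have : 0 < late P * (x0 - x) by rewrite mulr_gt0// subr_gt0.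
lra.
Qed.

End Maximizer.

Let drive_below x : t1 P <= x <= t2 P -> h x < K -> r x = lambda P.
Proof.
move=> xt hK; have /andP[_] := car_rate_range eqE xt.
rewrite le_eqVlt => /predU1P[//|rl].
by have := transit_ge_K (conj xt rl); rewrite leNgt hK.
Qed.

Let h_continuous : continuous h.
Proof. exact: min_cost_continuous. Qed.

Section Plateau.
Variable H : R.
Hypotheses (h_max : forall x, t1 P <= x <= t2 P -> h x <= H).

Let A_level x : t1 P <= x <= t2 P -> h x = H -> A x = G x.
Proof. by move=> xt hx; apply: cumul_maximizer => // y /h_max; rewrite hx. Qed.

(** Exits balance demand at both ends, so [lambda * (b - a)] cars would have to exit during [b - a],
    beyond the capacity [mu_f]. *)
Let drive_gap a b : t1 P <= a -> a < b -> b <= t2 P -> h a = H -> h b = H ->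
  (forall x, a < x < b -> r x = lambda P) -> False.
Proof.
move=> t1a ab bt ha hb rl.
have := A_lip (ltW ab).
rewrite !A_level//; last 2 first.
- by rewrite t1a (le_trans (ltW ab)).
- by rewrite bt (le_trans t1a)// ltW.
rewrite (G_sub t1a (ltW ab) bt rl) lerD2l leNgt.
by rewrite ltr_pM2r ?subr_gt0// mu_f_lambda.
Qed.

Let H_le_K x : t1 P <= x <= t2 P -> h x = H -> H <= K.
Proof. by move=> xt <-; exact: h_le_K. Qed.

(** If [h x < H], the nearest points at level [H] on either side enclose users with [h < H <= K].
    They all drive, which [drive_gap] forbids. *)
Lemma plateau a b x : t1 P <= a -> b <= t2 P -> h a = H -> h b = H ->
  a <= x <= b -> h x = H.
Proof.
move=> t1a bt ha hb /andP[ax xb].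
have xt : t1 P <= x <= t2 P by rewrite (le_trans t1a ax) (le_trans xb bt).
apply/eqP; rewrite eq_le h_max//= leNgt; apply/negP => hx.
have [||a' [/andP[aa' a'x] ha' a'max]] := @level_greatest R h a x H => //.
  by exists a => //; rewrite lexx.
have [||b' [/andP[xb' b'b] hb' b'min]] := @level_least R h x b H => //.
  by exists b => //; rewrite lexx xb.
have a't := le_trans t1a aa'; have b't := le_trans b'b bt.
have a'b' : a' < b'.
  rewrite lt_neqAle (le_trans a'x xb') andbT; apply/eqP => ab'.
  have ex : x = a' by apply: le_anti; rewrite a'x ab' xb'.
  by move: hx; rewrite ex ha' ltxx.
apply: (drive_gap a't a'b' b't ha' hb') => y /andP[a'y yb'].
have yt : t1 P <= y <= t2 P.
  by rewrite (le_trans a't (ltW a'y)) (le_trans (ltW yb') b't).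
apply: drive_below => //; apply: lt_le_trans (H_le_K (_ : t1 P <= a' <= t2 P) ha').
  rewrite lt_neqAle h_max// andbT; apply/eqP.
  have [yx|/ltW xy] := leP y x; first by apply: a'max; rewrite a'y.
  by apply: b'min; rewrite xy.
by rewrite a't (le_trans (ltW a'b')).
Qed.

End Plateau.

(** The witnesses are the maximum of [h] over the desired times and the first and last points
    attaining it. The middle flow is only bounded above, as the delay on the plateau may exceed
    [H]. *)
Lemma equilibrium_structure : exists H x1 x2,
  [/\ [/\ 0 <= H, H <= K, t1 P <= x1, x1 <= x2 & x2 <= t2 P],
      forall x, t1 P <= x <= t2 P -> h x <= H,
      lambda P * (x1 - t1 P) = ramp_mass P (early P) H,
      lambda P * (t2 P - x2) = ramp_mass P (late P) H &
      [/\ A (t_D E) = lambda P * (x1 - t1 P) + (A x2 - A x1)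
                       + lambda P * (t2 P - x2),
          A x2 - A x1 <= outflow P H * (x2 - x1) &
          H < K -> x1 = x2]].
Proof.
have [|x0] := @EVT_max R h (t1 P) (t2 P) (ltW t12).
  by apply: continuous_subspaceT => ?; exact: h_continuous.
rewrite in_itv/= => x0t h_max'; pose H := h x0.
have h_max x : t1 P <= x <= t2 P -> h x <= H.
  by move=> xt; apply: h_max'; rewrite in_itv.
have H_ge0 : 0 <= H by exact: min_cost_ge0.
have H_le : H <= K by exact: h_le_K.
have [||x1 [/andP[t1x1 x1x0] hx1 x1min]] := @level_least R h (t1 P) (t2 P) H => //.
  by exists x0.
have [||x2 [/andP[x1x2 x2t] hx2 x2max]] := @level_greatest R h x1 (t2 P) H => //.
  by exists x1 => //; rewrite lexx.
have x1t : t1 P <= x1 <= t2 P by rewrite t1x1.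
have x2t' : t1 P <= x2 <= t2 P by rewrite (le_trans t1x1).
have A1 : A x1 = G x1 by apply: cumul_maximizer => // y /h_max; rewrite hx1.
have A2 : A x2 = G x2 by apply: cumul_maximizer => // y /h_max; rewrite hx2.
have left_driver y : t1 P <= y < x1 -> r y = lambda P.
  move=> /andP[ty yx]; have yt : t1 P <= y <= t2 P by rewrite ty (le_trans (ltW yx)).
  apply: drive_below => //; apply: lt_le_trans H_le; rewrite lt_neqAle h_max// andbT.
  by apply/eqP; apply: x1min; rewrite ty.
have right_driver y : x2 < y <= t2 P -> r y = lambda P.
  move=> /andP[xy yt].
  have yt' : t1 P <= y <= t2 P by rewrite yt (le_trans t1x1)// (le_trans x1x2)// ltW.
  apply: drive_below => //; apply: lt_le_trans H_le; rewrite lt_neqAle h_max// andbT.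
  by apply/eqP; apply: x2max; rewrite xy.
have lambda_gt0 : 0 < lambda P by exact: lt_trans mu_f_lambda.
have driverP y : t1 P <= y <= t2 P -> r y = lambda P -> driver y.
  by move=> yt ry; split => //; rewrite -/r ry.
have G0 : G (t1 P) = 0 by rewrite /G set_itv1 Rintegral_set1.
have G1 y : t1 P <= y <= x1 -> G y = lambda P * (y - t1 P).
  move=> /andP[ty yx]; rewrite (G_sub (lexx _) ty _ (c := lambda P)) ?G0 ?add0r//.
    exact: le_trans yx x1x0.
  by move=> u /andP[tu uy]; apply: left_driver; rewrite ltW// (lt_le_trans uy).
have G2 y : x2 <= y <= t2 P -> G (t2 P) - G y = lambda P * (t2 P - y).
  move=> /andP[xy yt]; rewrite (G_sub _ yt (lexx _) (c := lambda P)).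
  - by rewrite addrC addKr.
  - by rewrite (le_trans t1x1)// (le_trans x1x2).
  - by move=> u /andP[yu ut]; apply: right_driver; rewrite ltW// (le_lt_trans xy).
have A1E : A x1 = lambda P * (x1 - t1 P) by rewrite A1 G1// t1x1 lexx.
have A_ge0 t : 0 <= A t by exact: cumul_ge0.
have A_le t : A t <= A (t_D E).
  have [tD|/ltW Dt] := leP t (t_D E); first exact: A_mono.
  by rewrite !A_end.
have M2 : A (t_D E) - A x2 = lambda P * (t2 P - x2).
  by rewrite A2 A_end// G2// lexx.
have cost_x1 t : H <= cost x1 t by rewrite -hx1; exact: min_cost_le.
have cost_x2 t : H <= cost x2 t by rewrite -hx2; exact: min_cost_le.
have left_T y : t1 P <= y < x1 -> A (T y) = lambda P * (y - t1 P).
  move=> /[dup] yl /andP[ty yx]; rewrite A_T ?G1 ?ty ?ltW//.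
  by apply: driverP; [rewrite ty (le_trans (ltW yx))|exact: left_driver].
have left_opt y : t1 P <= y < x1 -> forall s, cost y (T y) <= cost y s.
  move=> /[dup] yl /andP[ty yx]; apply: driver_opt.
  by apply: driverP; [rewrite ty (le_trans (ltW yx))|exact: left_driver].
have x1_inf eps : 0 < eps -> exists s, cost x1 s < H + eps.
  by move=> eps0; rewrite -hx1; exact: min_cost_adherent.
have start1 := ramp_start early_gt0 late_gt0 mu_f_gt0 mu_f_lambda H_ge0 t1x1 w_ge0
  A_ge0 A_lip A_mono A1E left_T left_opt cost_x1 x1_inf.
have delay1 := ramp_delay early_gt0 late_gt0 mu_f_gt0 mu_f_lambda w_ge0
  A_ge0 A_lip A_mono A_strict A1E left_T left_opt cost_x1 x1_inf.
(* In reversed time, [A'] counts the cars that have yet to exit and [- t2] plays the role of the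
   first desired time. *)
pose A' t := A (t_D E) - A (- t); pose T' y := - T (- y).
have w'_ge0 t : 0 <= (w \o -%R) t by exact: w_ge0.
have A'_ge0 t : 0 <= A' t by rewrite subr_ge0.
have A'_lip s t : s <= t -> A' t <= A' s + mu_f P * (t - s).
  rewrite -lerN2 => /A_lip; rewrite /A' opprK [- s + t]addrC; lra.
have A'_mono s t : s <= t -> A' s <= A' t.
  by rewrite -lerN2 => /A_mono; rewrite lerD2l lerN2.
have A'_strict s t : s < t -> (forall u, s < u < t -> 0 < (w \o -%R) u) ->
    A' s < A' t.
  move=> st wpos; rewrite ltrD2l ltrN2; apply: A_strict; first by rewrite ltrN2.
  move=> u /andP[tu us]; rewrite -[u]opprK; apply: wpos.
  by rewrite ltrNr us ltrNl.
have A2E : A' (- x2) = lambda P * (- x2 - - t2 P).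
  by rewrite /A' !opprK M2 addrC.
have right_memb y : - t2 P <= y < - x2 -> x2 < - y <= t2 P.
  by move=> /andP[ty yx]; rewrite ltrNr yx lerNl ty.
have right_desired y : x2 < y <= t2 P -> t1 P <= y <= t2 P.
  by move=> /andP[xy yt]; rewrite yt (le_trans t1x1)// (le_trans x1x2)// ltW.
have right_T y : - t2 P <= y < - x2 -> A' (T' y) = lambda P * (y - - t2 P).
  move=> /right_memb /[dup] yr /andP[xy yt].
  rewrite /A' /T' opprK A_T; last first.
    by apply: driverP; [exact: right_desired|exact: right_driver].
  by rewrite A_end// G2 ?yt ?(ltW xy)// !opprK addrC.
have right_opt y : - t2 P <= y < - x2 ->
    forall s, trip_cost (w \o -%R) (late P) (early P) y (T' y) <=
              trip_cost (w \o -%R) (late P) (early P) y s.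
  move=> /right_memb yr s; have dy : driver (- y).
    by apply: driverP; [exact: right_desired|exact: right_driver].
  by have := driver_opt dy (- s); rewrite /cost -!(trip_cost_opp w) !opprK.
have cost_x2' t : H <= trip_cost (w \o -%R) (late P) (early P) (- x2) t.
  by rewrite -[t]opprK trip_cost_opp; exact: cost_x2.
have x2_inf eps : 0 < eps ->
    exists s, trip_cost (w \o -%R) (late P) (early P) (- x2) s < H + eps.
  move=> eps0; have [s sH] : exists s, cost x2 s < H + eps.
    by rewrite -hx2; exact: min_cost_adherent.
  by exists (- s); rewrite trip_cost_opp.
have x2t_opp : - t2 P <= - x2 by rewrite lerN2.
have start2 := ramp_start late_gt0 early_gt0 mu_f_gt0 mu_f_lambda H_ge0 x2t_opp
  w'_ge0 A'_ge0 A'_lip A'_mono A2E right_T right_opt cost_x2' x2_inf.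
have delay2 := ramp_delay late_gt0 early_gt0 mu_f_gt0 mu_f_lambda w'_ge0
  A'_ge0 A'_lip A'_mono A'_strict A2E right_T right_opt cost_x2' x2_inf.
have mass1 : A x1 = ramp_mass P (early P) H.
  have := @cumul_ramp_up _ P m (mu_f P) (t_A E) (t_D E) mu_f_gt0 n_c_gt0 n_cj
    m_meas m_ge0 m_le m_out x1 H (early P) early_gt0 H_ge0.
  rewrite -/A start1 add0r; apply => u ru; have := delay1 u ru => wE.
  have /andP[xu _] := ru; rewrite m_congested wE//.
  by rewrite subr_gt0 mulrC -ltr_pdivlMr//; lra.
have mass2 : A (t_D E) - A x2 = ramp_mass P (late P) H.
  (* Read back through the reflection, [start2] says that every car has exited by
     [x2 + H / late]. *)
  have end2 : A (x2 + H / late P) = A (t_D E).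
    by have /eqP := start2; rewrite /A' opprD !opprK subr_eq0 => /eqP.
  have := @cumul_ramp_down _ P m (mu_f P) (t_A E) (t_D E) mu_f_gt0 n_c_gt0 n_cj
    m_meas m_ge0 m_le m_out x2 H (late P) late_gt0 H_ge0.
  rewrite -/A end2 => ->; first by rewrite addrC addKr.
  move=> u /andP[xu ux].
  have ru : - x2 - H / late P < - u < - x2 by rewrite ltrN2 xu -opprD ltrN2 ux.
  have := delay2 _ ru; rewrite /= opprK [- x2 + u]addrC => wE.
  rewrite m_congested wE//.
  by rewrite subr_gt0 mulrC -ltr_pdivlMr//; lra.
exists H, x1, x2; split => //.
- by rewrite -A1E.
- by rewrite -M2.
split.
- by rewrite -M2 -A1E; ring.
- rewrite lerBlDl; apply: (cumul_le m_meas m_ge0 m_le m_out x1x2) => u /andP[xu ux].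
  have hu : h u = H by apply: (plateau h_max t1x1 x2t hx1 hx2); rewrite !ltW.
  apply: le_trans (mfd_le_outflow _ _ _ _ (accum_range eqE u)) _ => //.
  apply: outflow_anti => //; rewrite -hu; exact: min_cost_le_delay.
- move=> HK; apply: le_anti; rewrite x1x2/= leNgt; apply/negP => x12.
  (* Below level [K] everyone drives, and a gap between [x1] and [x2] would exceed the capacity. *)
  have rl y : t1 P <= y <= t2 P -> r y = lambda P.
    by move=> yt; apply: drive_below => //; exact: le_lt_trans (h_max y yt) HK.
  have := A_lip x1x2; rewrite A1 A2 (G_sub t1x1 x1x2 x2t (c := lambda P)).
    by rewrite lerD2l leNgt ltr_pM2r ?subr_gt0// mu_f_lambda.
  move=> u /andP[xu ux]; apply: rl.
  by rewrite (le_trans t1x1 (ltW xu)) (le_trans (ltW ux) x2t).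
Qed.

Lemma indifferent_level x H : t1 P <= x <= t2 P -> indifferent P tau E x ->
  (forall y, t1 P <= y <= t2 P -> h y <= H) -> K <= H.
Proof. by move=> xt /indifferent_h <-; apply. Qed.

End Equilibrium.

(** * An equilibrium with trapezoidal delay *)

Section Ramps.
Context {R : realType}.
Variable P : urban_model R.
Hypotheses (mu_f_gt0 : 0 < mu_f P) (n_c_gt0 : 0 < n_c P) (n_cj : n_c P < n_j P).

Let nj0 : 0 < n_j P. Proof. exact: n_j_gt0 n_cj. Qed.

Lemma ramp_mass_ge0 s c : 0 < s -> 0 <= c -> 0 <= ramp_mass P s c.
Proof.
move=> s0 c0; rewrite mulr_ge0 ?divr_ge0 ?(ltW s0) ?(ltW nj0)//.
by rewrite ln_ge0// lerDl divr_ge0 ?mulr_ge0// ltW.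
Qed.

Lemma ramp_mass_mono s c d : 0 < s -> 0 <= c -> c < d ->
  ramp_mass P s c < ramp_mass P s d.
Proof.
move=> s0 c0 cd; have d0 := le_lt_trans c0 cd.
rewrite ltr_pM2l ?divr_gt0// ltr_ln ?posrE.
- by rewrite ltrD2l ltr_pM2r ?invr_gt0// ltr_pM2r.
- by rewrite ltr_pwDl// divr_ge0 ?mulr_ge0// ltW.
- by rewrite addr_gt0// divr_gt0 ?mulr_gt0.
Qed.

(* The congested accumulation at which the delay is [v]. *)
Definition congested_accum (v : R) : R :=
  n_j P - n_j P * (n_j P - n_c P) / (n_j P + mu_f P * v).

Let den_gt0 v : 0 <= v -> 0 < n_j P + mu_f P * v.
Proof. by move=> v0; rewrite ltr_wpDr// mulr_ge0// ltW. Qed.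

Lemma congested_accum_range v : 0 <= v -> n_c P <= congested_accum v < n_j P.
Proof.
move=> v0; have d0 := den_gt0 v0; apply/andP; split.
  rewrite lerBrDl -lerBrDr ler_pdivrMr// -subr_ge0.
  rewrite [X in 0 <= X](_ : _ = (n_j P - n_c P) * mu_f P * v); last by ring.
  by rewrite !mulr_ge0// ?subr_ge0 ltW.
by rewrite ltrBlDr ltrDl divr_gt0// mulr_gt0// subr_gt0.
Qed.

Lemma delay_congested_accum v : 0 < trip_length P -> 0 <= v ->
  delay P (congested_accum v) = v.
Proof.
move=> D0 v0; rewrite delay_congested ?congested_accum_range//.
have d0 := den_gt0 v0; rewrite /congested_accum; field.
rewrite !gt_eqF//=.
rewrite [X in 0 < X](_ : _ = n_j P * (n_j P - n_c P)); last by ring.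
by rewrite mulr_gt0// subr_gt0.
Qed.

(** The formula has a pole at a negative delay; taking the positive part first makes it continuous
    on the whole line. *)
Lemma measurable_congested_accum (f : R -> R) :
  measurable_fun setT f -> (forall t, 0 <= f t) ->
  measurable_fun setT (fun t => congested_accum (f t)).
Proof.
move=> mf f0.
have -> : (fun t => congested_accum (f t)) =
    (fun v => congested_accum (Num.max v 0)) \o f.
  by apply/funext => t /=; rewrite max_l.
apply: measurableT_comp => //; apply: continuous_measurable_fun => v.
apply: cvgB; first exact: cvg_cst.
apply: cvgM; first exact: cvg_cst.
apply: cvgV; first by rewrite gt_eqF// den_gt0// le_max lexx orbT.
apply: cvgD; first exact: cvg_cst.
apply: cvgM; first exact: cvg_cst.
by apply: (@continuous_max _ _ (@id R) (cst 0)); [exact: cvg_id|exact: cvg_cst].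
Qed.

End Ramps.

Section Construction.
Context {R : realType}.
Notation leb := (@lebesgue_measure R).
Variables (P : urban_model R) (tau : R).
Hypotheses (t12 : t1 P < t2 P)
  (mu_f_gt0 : 0 < mu_f P) (n_c_gt0 : 0 < n_c P) (n_cj : n_c P < n_j P)
  (trip_length_gt0 : 0 < trip_length P)
  (early_gt0 : 0 < early P) (late_gt0 : 0 < late P)
  (mu_f_lambda : mu_f P < lambda P) (tau_le : tau <= z_T P - z_C P).

Let K := z_T P - z_C P - tau.
Let g := outflow P K.
Let QE := ramp_mass P (early P) K.
Let QL := ramp_mass P (late P) K.

Hypothesis ramps_fit : QE + QL <= lambda P * (t2 P - t1 P).

Let lambda_gt0 : 0 < lambda P. Proof. exact: lt_trans mu_f_lambda. Qed.
Let K_ge0 : 0 <= K. Proof. by rewrite subr_ge0. Qed.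
Let QE_ge0 : 0 <= QE. Proof. exact: ramp_mass_ge0. Qed.
Let QL_ge0 : 0 <= QL. Proof. exact: ramp_mass_ge0. Qed.
Let g_gt0 : 0 < g. Proof. exact: outflow_gt0. Qed.
Let g_lambda : g < lambda P.
Proof. exact: le_lt_trans (outflow_le_mu _ _ _ K_ge0) mu_f_lambda. Qed.

(** [x1] and [x2] cut off exactly the users who fill the two ramps; [tA] and [tD] are where delays
    of slopes [early] and [late] descend from [K] to zero. *)
Let x1 := t1 P + QE / lambda P.
Let x2 := t2 P - QL / lambda P.
Let tA := x1 - K / early P.
Let tD := x2 + K / late P.

Let t1x1 : t1 P <= x1. Proof. by rewrite lerDl divr_ge0// ltW. Qed.
Let x2t2 : x2 <= t2 P. Proof. by rewrite lerBlDr lerDl divr_ge0// ltW. Qed.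
Let x1x2 : x1 <= x2.
Proof.
rewrite /x1 /x2 -subr_ge0.
have -> : t2 P - QL / lambda P - (t1 P + QE / lambda P) =
    (lambda P * (t2 P - t1 P) - (QE + QL)) / lambda P.
  by field; rewrite gt_eqF.
by rewrite divr_ge0 ?subr_ge0// ltW.
Qed.
Let tAx1 : tA <= x1. Proof. by rewrite lerBlDr lerDl divr_ge0// ltW. Qed.
Let x2tD : x2 <= tD. Proof. by rewrite lerDl divr_ge0// ltW. Qed.

Let trap t := K - early P * Num.max (x1 - t) 0 - late P * Num.max (t - x2) 0.
Let profile t := Num.max (trap t) 0.

Let trap_left t : t <= x1 -> trap t = K - early P * (x1 - t).
Proof.
move=> tx; rewrite /trap max_l ?subr_ge0// max_r ?mulr0 ?subr0//.
by rewrite subr_le0 (le_trans tx).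
Qed.

Let trap_mid t : x1 <= t <= x2 -> trap t = K.
Proof.
by move=> /andP[xt tx]; rewrite /trap !max_r ?subr_le0// !mulr0 !subr0.
Qed.

Let trap_right t : x2 <= t -> trap t = K - late P * (t - x2).
Proof.
move=> xt; rewrite /trap max_r ?mulr0 ?subr0 ?max_l ?subr_ge0//.
by rewrite subr_le0 (le_trans x1x2).
Qed.

Let profile_ge0 t : 0 <= profile t. Proof. by rewrite le_max lexx orbT. Qed.

Let profile_in t : tA <= t <= tD -> profile t = trap t.
Proof.
move=> /andP[At tD']; rewrite /profile max_l//.
have [tx1|/ltW x1t] := leP t x1.
  rewrite trap_left// subr_ge0 mulrC -ler_pdivlMr//.
  by move: At; rewrite /tA; lra.
have [tx2|/ltW x2t] := leP t x2; first by rewrite trap_mid// x1t.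
rewrite trap_right// subr_ge0 mulrC -ler_pdivlMr//.
by move: tD'; rewrite /tD; lra.
Qed.

Let profile_out t : ~ (tA <= t <= tD) -> profile t = 0.
Proof.
move=> /negP; rewrite negb_and -!ltNge => tAD; rewrite /profile max_r//.
case/orP: tAD => tAD.
  rewrite trap_left; last by rewrite (le_trans (ltW tAD)).
  rewrite subr_le0 mulrC -ler_pdivrMr//.
  by move: tAD; rewrite /tA; lra.
rewrite trap_right; last by rewrite (le_trans x2tD)// ltW.
rewrite subr_le0 mulrC -ler_pdivrMr//.
by move: tAD; rewrite /tD; lra.
Qed.

(** The delay never varies faster than the penalties compensate: this is subadditivity of the
    positive part along [x1], [x], [t] and along [t], [x], [x2]. *)
Let trap_le_cost x t : trap x <= trip_cost profile (early P) (late P) x t.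
Proof.
have trap_le : trap t <= profile t by rewrite le_max lexx.
have max_shift u v : Num.max (u + v) 0 <= Num.max u 0 + Num.max v (0 : R).
  by rewrite ge_max lerD ?le_max ?lexx//= addr_ge0// le_max lexx orbT.
have m1 := max_shift (x1 - x) (x - t); rewrite addrA subrK in m1.
have m2 := max_shift (t - x) (x - x2); rewrite addrA subrK in m2.
have := ler_wpM2l (ltW early_gt0) m1; have := ler_wpM2l (ltW late_gt0) m2.
by move: trap_le; rewrite /trap /trip_cost; lra.
Qed.

(** Zero delay inside the interval is realized at [n_c], as the tie-breaking rule demands. *)
Let n t := if tA <= t <= tD then congested_accum P (profile t) else 0.
Let m t := mfd P (n t).

Let n_range t : 0 <= n t < n_j P.
Proof.
rewrite /n; case: ifP => _; last by rewrite lexx (n_j_gt0 n_c_gt0).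
have /andP[nc ->] := congested_accum_range mu_f_gt0 n_c_gt0 n_cj (profile_ge0 t).
by rewrite (le_trans (ltW n_c_gt0)).
Qed.

Let n_delay t : delay P (n t) = profile t.
Proof.
rewrite /n; case: ifPn => [_|/negP/profile_out ->].
  exact: delay_congested_accum.
by rewrite /delay eqxx.
Qed.

Let m_in t : tA <= t <= tD -> m t = outflow P (profile t).
Proof.
move=> tAD; rewrite /m -n_delay mfd_congested_outflow// /n tAD.
exact: congested_accum_range.
Qed.

Let n_meas : measurable_fun setT n.
Proof.
apply: measurable_fun_ifT => //.
  by apply: measurable_and; exact: measurable_fun_ler.
apply: measurable_congested_accum => //; apply: measurable_maxr => //.
apply: measurable_funB; last first.
  apply: measurable_funM => //; apply: measurable_maxr => //.
  exact: measurable_funB.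
apply: measurable_funB => //; apply: measurable_funM => //.
by apply: measurable_maxr => //; exact: measurable_funB.
Qed.

Let m_meas : measurable_fun setT m.
Proof. exact: measurable_mfd. Qed.

Let m_ge0 t : 0 <= m t. Proof. exact: mfd_ge0. Qed.
Let m_le t : m t <= mu_f P. Proof. exact: mfd_le. Qed.
Let m_out t : ~ (tA <= t <= tD) -> m t = 0.
Proof. by rewrite /m /n => /negP/negbTE->; rewrite mfd0. Qed.

Let A := cumul m.

Let A_strict s t : tA <= s -> s < t -> t <= tD -> A s < A t.
Proof.
move=> As st tD'; apply: (cumul_strict m_meas m_ge0 m_le m_out st) => u /andP[su ut].
rewrite m_in ?outflow_gt0//.
by rewrite (le_trans As (ltW su)) (le_trans (ltW ut)).
Qed.

Let A_le s t : tA <= s <= tD -> tA <= t <= tD -> (A s <= A t) = (s <= t).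
Proof.
move=> /andP[As sD] /andP[At tD']; apply/idP/idP => [|st]; last first.
  exact: (cumul_mono m_meas m_ge0 m_le m_out).
by rewrite !leNgt; apply: contra => ts; exact: A_strict.
Qed.

Let tAD : tA <= tD.
Proof. exact: le_trans tAx1 (le_trans x1x2 x2tD). Qed.

Let x1_in : tA <= x1 <= tD.
Proof. by rewrite tAx1 (le_trans x1x2). Qed.

Let x2_in : tA <= x2 <= tD.
Proof. by rewrite x2tD andbT (le_trans tAx1). Qed.

Let A_tA : A tA = 0. Proof. exact: (cumul_start m_meas m_ge0 m_le m_out). Qed.

Let A_x1 : A x1 = QE.
Proof.
rewrite /A (cumul_ramp_up mu_f_gt0 n_c_gt0 n_cj m_meas m_ge0 m_le m_out early_gt0 K_ge0).
  by rewrite -/tA -/A A_tA add0r.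
move=> u /andP[Au ux]; have uin : tA <= u <= tD.
  by rewrite ltW//= (le_trans (ltW ux))//; case/andP: x1_in.
by rewrite m_in// profile_in// trap_left// ltW.
Qed.

Let A_mid t : x1 <= t <= x2 -> A t = QE + g * (t - x1).
Proof.
move=> /andP[xt tx].
rewrite /A (cumul_cst m_meas m_ge0 m_le m_out (c := g) xt) -/A ?A_x1//.
move=> u /andP[xu ut]; have uin : tA <= u <= tD.
  by rewrite (le_trans tAx1 (ltW xu)) (le_trans (ltW ut))// (le_trans tx).
by rewrite m_in// profile_in// trap_mid// (ltW xu) (le_trans (ltW ut)).
Qed.

Let A_tD : A tD = A x2 + QL.
Proof.
rewrite /A (cumul_ramp_down mu_f_gt0 n_c_gt0 n_cj m_meas m_ge0 m_le m_out late_gt0 K_ge0)//.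
move=> u /andP[xu uD]; have uin : tA <= u <= tD.
  by rewrite [u <= _]ltW// andbT (le_trans _ (ltW xu))//; case/andP: x2_in.
by rewrite m_in// profile_in// trap_right// ltW.
Qed.

(** Between [x1] and [x2] the demand [g] equals the outflow at delay [K], so these drivers can exit
    exactly on time. The value 0 outside makes [cumul] applicable. *)
Let rate x := if t1 P <= x <= t2 P then (if x1 <= x <= x2 then g else lambda P)
              else 0.

Let rate_meas : measurable_fun setT rate.
Proof.
apply: measurable_fun_ifT => //.
  by apply: measurable_and; exact: measurable_fun_ler.
apply: measurable_fun_ifT => //.
by apply: measurable_and; exact: measurable_fun_ler.
Qed.

Let rate_pos x : t1 P <= x <= t2 P -> 0 < rate x.
Proof. by rewrite /rate => ->; case: ifP. Qed.

Let rate_ge0 x : 0 <= rate x.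
Proof. by rewrite /rate; case: ifP => // _; case: ifP => _; exact: ltW. Qed.

Let rate_le x : rate x <= lambda P.
Proof.
rewrite /rate; case: ifP => _; last exact: ltW.
by case: ifP => // _; exact: ltW.
Qed.

Let rate_out x : ~ (t1 P <= x <= t2 P) -> rate x = 0.
Proof. by rewrite /rate => /negP/negbTE->. Qed.

Let G := cumul rate.

Let G_strict x y : t1 P <= x -> x < y -> y <= t2 P -> G x < G y.
Proof.
move=> tx xy yt; apply: (cumul_strict rate_meas rate_ge0 rate_le rate_out xy).
move=> u /andP[xu uy]; apply: rate_pos.
by rewrite (le_trans tx (ltW xu)) (le_trans (ltW uy)).
Qed.

Let G_le x y : t1 P <= x <= t2 P -> t1 P <= y <= t2 P -> (G x <= G y) = (x <= y).
Proof.
move=> /andP[tx xt] /andP[ty yt]; apply/idP/idP => [|xy]; last first.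
  exact: (cumul_mono rate_meas rate_ge0 rate_le rate_out).
by rewrite !leNgt; apply: contra => yx; exact: G_strict.
Qed.

Let G_t1 : G (t1 P) = 0.
Proof. exact: (cumul_start rate_meas rate_ge0 rate_le rate_out). Qed.

Let G_left x : t1 P <= x <= x1 -> G x = lambda P * (x - t1 P).
Proof.
move=> /andP[tx xx].
rewrite /G (cumul_cst rate_meas rate_ge0 rate_le rate_out (c := lambda P) tx).
  by rewrite -/G G_t1 add0r.
move=> u /andP[tu ux]; have ux1 := lt_le_trans ux xx.
rewrite /rate (ltW tu) (le_trans (ltW ux1) (le_trans x1x2 x2t2))/=.
by rewrite leNgt ux1.
Qed.

Let lambda_x1 : lambda P * (x1 - t1 P) = QE.
Proof. by rewrite /x1 addrC addKr mulrC divfK// gt_eqF. Qed.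

Let lambda_x2 : lambda P * (t2 P - x2) = QL.
Proof. by rewrite /x2 subKr mulrC divfK// gt_eqF. Qed.

Let G_x1 : G x1 = QE.
Proof. by rewrite G_left ?lambda_x1// t1x1 lexx. Qed.

Let G_mid x : x1 <= x <= x2 -> G x = QE + g * (x - x1).
Proof.
move=> /andP[xx' xx].
rewrite /G (cumul_cst rate_meas rate_ge0 rate_le rate_out (c := g) xx').
  by rewrite -/G G_x1.
move=> u /andP[xu ux]; have ux2 := le_trans (ltW ux) xx.
by rewrite /rate (le_trans t1x1 (ltW xu)) (le_trans ux2 x2t2)/= (ltW xu) ux2.
Qed.

Let G_right x : x2 <= x <= t2 P -> G x = G x2 + lambda P * (x - x2).
Proof.
move=> /andP[xx xt].
rewrite /G (cumul_cst rate_meas rate_ge0 rate_le rate_out (c := lambda P) xx)//.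
move=> u /andP[xu ux]; rewrite /rate (le_trans (ltW ux) xt).
rewrite (le_trans t1x1 (le_trans x1x2 (ltW xu)))/=.
by rewrite andbC leNgt xu.
Qed.

Let G_A_mid x : x1 <= x <= x2 -> G x = A x.
Proof. by move=> xx; rewrite G_mid// A_mid. Qed.

Let G_A_x2 : G x2 = A x2.
Proof. by rewrite G_A_mid// x1x2 lexx. Qed.

Let G_t2 : G (t2 P) = A tD.
Proof. by rewrite G_right ?x2t2 ?lexx// A_tD lambda_x2 G_A_x2. Qed.

(** The implication stands under the quantifier so that [choice] yields a total exit-time
    function. *)
Let A_inverse x : exists t, t1 P <= x <= t2 P -> tA <= t <= tD /\ A t = G x.
Proof.
have [xt|nxt] := boolP (t1 P <= x <= t2 P); last by exists 0.
have t2' : t1 P <= t2 P <= t2 P by rewrite lexx ltW.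
have t1' : t1 P <= t1 P <= t2 P by rewrite lexx ltW.
have [||t] := @IVT R A tA tD (G x) tAD.
- by apply: continuous_subspaceT => ?; exact: (cumul_continuous m_meas m_ge0 m_le m_out).
- have AA : A tA <= A tD by rewrite A_le// ?lexx ?tAD.
  rewrite min_l// max_r// A_tA -G_t1 -G_t2 !G_le//.
by rewrite in_itv/= => tin tE; exists t.
Qed.

Let G_inverse t : tA <= t <= tD -> exists2 y, t1 P <= y <= t2 P & G y = A t.
Proof.
move=> tin; have t2' : t1 P <= t2 P <= t2 P by rewrite lexx ltW.
have t1' : t1 P <= t1 P <= t2 P by rewrite lexx ltW.
have [||y] := @IVT R G (t1 P) (t2 P) (A t) (ltW t12).
- apply: continuous_subspaceT => ?.
  exact: (cumul_continuous rate_meas rate_ge0 rate_le rate_out).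
- have GG : G (t1 P) <= G (t2 P) by rewrite G_le// ltW.
  by rewrite min_l// max_r// G_t1 G_t2 -A_tA !A_le// ?lexx ?tAD.
by rewrite in_itv/=; exists y.
Qed.

(** Driver [x] exits when cumulative exits reach [G x]. This costs [trap x], the lower bound of
    [trap_le_cost], hence is optimal. *)
Lemma trapezoid_equilibrium : exists E,
  [/\ equilibrium P (static_toll tau) E,
      forall t, t_A E <= t <= t_D E -> wait P E t = 0 -> accum E t = n_c P &
      cumul (fun t => mfd P (accum E t)) (t_D E) =
      QE + outflow P K * (x2 - x1) + QL].
Proof.
have [T TE] := choice A_inverse.
have T_in x : t1 P <= x <= t2 P -> tA <= T x <= tD by move=> /TE[].
have A_T x : t1 P <= x <= t2 P -> A (T x) = G x by move=> /TE[].
pose E := Outcome n rate T tA tD.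
have waitE t : wait P E t = profile t by exact: n_delay.
have has_carE x : has_car P E x <-> t1 P <= x <= t2 P.
  by split => [[]//|xt]; split => //; exact: rate_pos.
have T_mono x y : t1 P <= x <= t2 P -> t1 P <= y <= t2 P -> (T x <= T y) = (x <= y).
  by move=> xt yt; rewrite -A_le ?T_in// !A_T// G_le.
have x1_des : t1 P <= x1 <= t2 P by rewrite t1x1 (le_trans x1x2).
have x2_des : t1 P <= x2 <= t2 P by rewrite x2t2 (le_trans t1x1).
have T_mid x : x1 <= x <= x2 -> T x = x.
  move=> /[dup] xx /andP[xx1 xx2].
  have xt : t1 P <= x <= t2 P by rewrite (le_trans t1x1) ?(le_trans xx2).
  have xin : tA <= x <= tD by rewrite (le_trans tAx1) ?(le_trans xx2).
  have Tin := T_in _ xt; apply: le_anti.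
  by rewrite -(A_le Tin xin) -(A_le xin Tin) A_T// G_A_mid// lexx.
have lip := cumul_lip m_meas m_ge0 m_le m_out.
(* The [lambda * (x1 - x)] users from [x] to [x1] exit at rate at most [mu_f], so the first of them
   must leave early. *)
have T_left x : t1 P <= x <= x1 -> T x <= x.
  move=> /[dup] xx /andP[tx xx1].
  have xt : t1 P <= x <= t2 P by rewrite tx (le_trans xx1)// (le_trans x1x2).
  have Tx1 : T x <= x1 by rewrite -[leRHS]T_mid ?T_mono ?lexx.
  have := lip _ _ Tx1; rewrite -/A A_x1 A_T// G_left// -lambda_x1.
  have : mu_f P * (x1 - x) <= lambda P * (x1 - x).
    by rewrite ler_wpM2r ?subr_ge0// ltW.
  move=> h1 h2; have : mu_f P * (x1 - x) <= mu_f P * (x1 - T x) by lra.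
  by rewrite ler_pM2l//; lra.
have T_right x : x2 <= x <= t2 P -> x <= T x.
  move=> /[dup] xx /andP[xx2 xt2].
  have xt : t1 P <= x <= t2 P by rewrite xt2 (le_trans _ xx2)// (le_trans t1x1).
  have Tx2 : x2 <= T x by rewrite -[leLHS]T_mid ?T_mono ?lexx ?x1x2.
  have := lip _ _ Tx2; rewrite -/A A_T// G_right// G_A_x2.
  have : mu_f P * (x - x2) <= lambda P * (x - x2).
    by rewrite ler_wpM2r ?subr_ge0// ltW.
  move=> h1 h2; have : mu_f P * (x - x2) <= mu_f P * (T x - x2) by lra.
  by rewrite ler_pM2l//; lra.
have cost_T x : t1 P <= x <= t2 P ->
    trip_cost profile (early P) (late P) x (T x) = trap x.
  move=> xt; have /andP[tx xt2] := xt.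
  have [xx1|/ltW x1x] := leP x x1.
    have Txx : T x <= x by apply: T_left; rewrite tx.
    rewrite trip_cost_early// profile_in ?T_in// !trap_left// ?(le_trans Txx)//.
    by ring.
  have [xx2|/ltW x2x] := leP x x2.
    have xx : x1 <= x <= x2 by rewrite x1x.
    have xin := T_in _ xt; rewrite T_mid// in xin *.
    by rewrite trip_cost_early// subrr mulr0 addr0 profile_in.
  have Txx : x <= T x by apply: T_right; rewrite x2x.
  rewrite trip_cost_late// profile_in ?T_in// !trap_right// ?(le_trans x2x)//.
  by ring.
have trap_le x : trap x <= K.
  rewrite /trap -addrA gerDl -opprD oppr_le0 addr_ge0// mulr_ge0 ?le_max ?lexx ?orbT//.
    exact: ltW.
  exact: ltW.
have car_costE t x : car_cost P (wait P E) (static_toll tau) t x =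
    z_C P + trip_cost profile (early P) (late P) x t + tau.
  by rewrite /car_cost waitE /trip_cost /static_toll !addrA.
have flow y : t1 P <= y <= t2 P -> \int[leb]_(x in `[t1 P, y]) rate x = G y.
  move=> /andP[ty yt]; rewrite /G (cumul_sub rate_meas rate_ge0 rate_le rate_out ty).
  rewrite -/G G_t1 add0r Rintegral_itv_cc_oo//.
  exact: (flow_integrable rate_meas rate_ge0 rate_le rate_out).
have flow_upto t y : t1 P <= y <= t2 P ->
    (forall x, t1 P <= x <= t2 P -> (T x <= t) = (x <= y)) ->
    \int[leb]_(x in [set x | has_car P E x /\ T x <= t]) rate x = G y.
  move=> yt Ty; rewrite -flow//; congr (Rintegral _ _ _).
  apply/seteqP; split => x /=; rewrite in_itv/=.
    by move=> [/has_carE xt]; rewrite Ty// => ->; case/andP: xt => ->.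
  move=> /andP[tx xy]; have xt : t1 P <= x <= t2 P.
    by rewrite tx (le_trans xy)//; case/andP: yt.
  by rewrite Ty//; split => //; apply/has_carE.
exists E; split; last 2 first.
- move=> t tin; rewrite waitE /= => p0.
  move: tin; rewrite /n /= => ->; rewrite p0 /congested_accum mulr0 addr0.
  have nj0 := n_j_gt0 n_c_gt0 n_cj.
  by rewrite mulrC mulKf ?gt_eqF// subKr.
- by rewrite /= -/m -/A A_tD A_mid// x1x2 lexx.
split => //=.
- by move=> t /negP/negbTE tn; rewrite /n tn.
- exact: measurable_funTS.
- by move=> x xt; rewrite rate_ge0 rate_le.
- by move=> x /has_carE; exact: T_in.
- by move=> x y /has_carE xt /has_carE yt; rewrite T_mono.
- move=> t; rewrite -/m -/(cumul m t) -/A.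
  have [tA'|tA'] := ltP t tA.
    rewrite /A (cumul_start m_meas m_ge0 m_le m_out) ?(ltW tA')//.
    rewrite (_ : [set x | _] = set0) ?Rintegral_set0//.
    apply/seteqP; split => // x [/has_carE/T_in/andP[Ax _]].
    by rewrite leNgt (lt_le_trans tA').
  have [tD'|/ltW tD'] := leP t tD; last first.
    rewrite /A (cumul_end m_meas m_ge0 m_le m_out tD') -/A -G_t2.
    apply: flow_upto => [|x xt]; first by rewrite lexx ltW.
    have /andP[_ ->] := xt; have /andP[_ TD] := T_in _ xt.
    exact: le_trans TD tD'.
  have tin : tA <= t <= tD by rewrite tA'.
  (* [y] is the last user out by time [t]. *)
  have [y yt Gy] := G_inverse tin; rewrite -Gy; apply: flow_upto => // x xt.
  by rewrite -A_le ?T_in// A_T// -Gy G_le.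
- move=> x /has_carE xt; split => [t|].
    by rewrite !car_costE lerD2r lerD2l cost_T.
  by rewrite car_costE cost_T//; have := trap_le x; rewrite /K; lra.
(* Transit is used only between [x1] and [x2], where the lower bound [trap] equals [K]. *)
- move=> x [xt] /=; rewrite /rate xt; case: ifPn => [xx _|_]; last by rewrite ltxx.
  move=> t; rewrite car_costE; have := trap_le_cost x t.
  by rewrite trap_mid// /K; lra.
Qed.

End Construction.

(** * Revenue *)

Section Revenue.
Context {R : realType}.
Variable P : urban_model R.
Hypotheses (t12 : t1 P < t2 P)
  (mu_f_gt0 : 0 < mu_f P) (n_c_gt0 : 0 < n_c P) (n_cj : n_c P < n_j P)
  (trip_length_gt0 : 0 < trip_length P)
  (early_gt0 : 0 < early P) (late_gt0 : 0 < late P)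
  (mu_f_lambda : mu_f P < lambda P).

Let lambda_gt0 : 0 < lambda P. Proof. exact: lt_trans mu_f_lambda. Qed.

Definition ramps_mass (c : R) : R :=
  ramp_mass P (early P) c + ramp_mass P (late P) c.

Lemma ramps_mass_mono c d : 0 <= c -> c < d -> ramps_mass c < ramps_mass d.
Proof. by move=> c0 cd; rewrite ltrD ?ramp_mass_mono. Qed.

(** The bracket is the length left between the ramps once their users, of density [lambda], are
    removed from the desired times. *)
Definition car_mass (c : R) : R :=
  ramps_mass c + outflow P c * (t2 P - t1 P - ramps_mass c / lambda P).

(** An indifferent user pays [K] at best, which forces [H = K]; the ramps fit because [x1 <= x2]. *)
Lemma indifferent_ramps_fit tau E x : tau <= z_T P - z_C P ->
  equilibrium P (static_toll tau) E -> desired P x -> indifferent P tau E x ->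
  ramps_mass (z_T P - z_C P - tau) <= lambda P * (t2 P - t1 P).
Proof.
move=> tau_le eqE xt xi.
have [H [y1 [y2 [[_ HK _ y12 _] hH m1 m2 _]]]] :=
  equilibrium_structure t12 mu_f_gt0 n_c_gt0 n_cj trip_length_gt0 early_gt0
    late_gt0 mu_f_lambda tau_le eqE.
have KH := indifferent_level mu_f_gt0 n_c_gt0 n_cj trip_length_gt0 early_gt0
  late_gt0 eqE xt xi hH.
have <- : H = z_T P - z_C P - tau by apply: le_anti; rewrite HK.
have := mulr_ge0 (ltW lambda_gt0) (_ : 0 <= y2 - y1).
rewrite subr_ge0 => /(_ y12).
by rewrite /ramps_mass -m1 -m2; lra.
Qed.

Lemma equilibrium_mass_le tau E : tau <= z_T P - z_C P ->
  ramps_mass (z_T P - z_C P - tau) <= lambda P * (t2 P - t1 P) ->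
  equilibrium P (static_toll tau) E ->
  cumul (fun t => mfd P (accum E t)) (t_D E) <= car_mass (z_T P - z_C P - tau).
Proof.
move=> tau_le fit eqE.
have [H [y1 [y2 [[H0 HK _ _ _] hH m1 m2 [-> le12 eq12]]]]] :=
  equilibrium_structure t12 mu_f_gt0 n_c_gt0 n_cj trip_length_gt0 early_gt0
    late_gt0 mu_f_lambda tau_le eqE.
have Q12 : ramps_mass H = lambda P * (t2 P - t1 P) - lambda P * (y2 - y1).
  by rewrite /ramps_mass -m1 -m2; ring.
move: HK; rewrite le_eqVlt => /predU1P[HK|HK]; last first.
  (* With [H] below [K] the middle is empty and the ramps at level [H] already carry all users;
     those at level [K] would exceed the total mass. *)
  have := ramps_mass_mono H0 HK.
  by rewrite Q12 (eq12 HK) subrr mulr0 subr0 ltNge fit.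
rewrite -HK; have -> : car_mass H = ramps_mass H + outflow P H * (y2 - y1).
  rewrite /car_mass [X in _ - X / _]Q12; congr (_ + _ * _).
  by field; rewrite gt_eqF.
by rewrite m1 m2 /ramps_mass; lra.
Qed.

Lemma selected_equilibrium_exists tau : 0 <= tau -> tau <= z_T P - z_C P ->
  ramps_mass (z_T P - z_C P - tau) <= lambda P * (t2 P - t1 P) ->
  exists2 E, selected_equilibrium P tau E &
    revenue P tau E = tau * car_mass (z_T P - z_C P - tau).
Proof.
move=> tau0 tau_le fit.
have [E [eqE crit mE]] := trapezoid_equilibrium t12 mu_f_gt0 n_c_gt0 n_cj
  trip_length_gt0 early_gt0 late_gt0 mu_f_lambda tau_le fit.
have revE : revenue P tau E = tau * car_mass (z_T P - z_C P - tau).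
  rewrite (revenue_total _ _ _ eqE)// mE; congr (_ * _).
  by rewrite /car_mass /ramps_mass; ring.
exists E => //; split => // E' eqE'.
rewrite revE (revenue_total _ _ _ eqE')// ler_wpM2l//.
exact: equilibrium_mass_le.
Qed.

End Revenue.

Theorem theorem5 (R : realType) (P : urban_model R) (tau_min tau : R)
  (Lambda_gt0 : 0 < Lambda P) (t12 : t1 P < t2 P)
  (mu_f_gt0 : 0 < mu_f P) (n_c_gt0 : 0 < n_c P) (n_cj : n_c P < n_j P)
  (trip_length_gt0 : 0 < trip_length P)
  (early_gt0 : 0 < early P) (early_lt1 : early P < 1) (late_gt0 : 0 < late P)
  (mu_f_lambda : mu_f P < lambda P) (z_CT : z_C P <= z_T P)
  (tau_minP : is_min_indifference_toll P tau_min)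
  (tau_range : tau_min <= tau <= z_T P - z_C P) :
  (exists E, selected_equilibrium P tau E) /\
  forall E, selected_equilibrium P tau E ->
    revenue P tau E =
    tau * (Lambda P / lambda P *
             (n_j P / (n_j P / mu_f P + z_T P - z_C P - tau))
           + n_j P * ((early P + late P) / (early P * late P)) *
             ln (1 + (z_T P - z_C P - tau) * mu_f P / n_j P) *
             (1 - 1 / lambda P *
                  (n_j P / (n_j P / mu_f P + z_T P - z_C P - tau)))).
Proof.
have [tau_min0 [E0 [eqE0 _ _] [x0 x0t x0i]] _] := tau_minP.
have /andP[tau_minle tau_le] := tau_range.
have fit : ramps_mass P (z_T P - z_C P - tau) <= lambda P * (t2 P - t1 P).
  (* Raising the toll from [tau_min] lowers [K], and ramp masses increase with [K], so the fit at
     [tau_min] passes to [tau]. *)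
  apply: le_trans (indifferent_ramps_fit _ _ _ _ _ _ _ _ _ eqE0 x0t x0i) => //.
    have K0 : 0 <= z_T P - z_C P - tau by rewrite subr_ge0.
    have : z_T P - z_C P - tau <= z_T P - z_C P - tau_min by rewrite lerD2l lerN2.
    by rewrite le_eqVlt => /predU1P[->//|/ramps_mass_mono] => H; apply/ltW/H.
  exact: le_trans tau_minle tau_le.
have [E selE revE] := selected_equilibrium_exists t12 mu_f_gt0 n_c_gt0 n_cj
  trip_length_gt0 early_gt0 late_gt0 mu_f_lambda (le_trans tau_min0 tau_minle)
  tau_le fit.
split=> [|E' selE']; first by exists E.
(* Each selected equilibrium maximizes revenue over all equilibria, so any two have equal
   revenue. *)
have -> : revenue P tau E' = revenue P tau E.
  apply: le_anti; rewrite (selected_max selE) ?(selected_max selE')//.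
    exact: selected_is_equilibrium selE.
  exact: selected_is_equilibrium selE'.
rewrite revE; congr (_ * _); rewrite /car_mass.
have -> : n_j P / (n_j P / mu_f P + z_T P - z_C P - tau) =
    outflow P (z_T P - z_C P - tau) by rewrite /outflow !addrA.
have -> : Lambda P / lambda P = t2 P - t1 P.
  by rewrite /lambda; field; rewrite !gt_eqF// subr_gt0.
have -> : ramps_mass P (z_T P - z_C P - tau) =
    n_j P * ((early P + late P) / (early P * late P)) *
    ln (1 + (z_T P - z_C P - tau) * mu_f P / n_j P).
  by rewrite /ramps_mass /ramp_mass; field; rewrite !gt_eqF.
by ring.
Qed.
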